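(* Let $w$ be a weight on $\mathbb{R}^n$. (1) Let $f$ be a nonconstant locally integrable function on $\mathbb{R}^n$ such that $Mf$ is not identically infinite. If $w\in A_\infty$, then for any cube $Q$ and $1\le p <\infty$, $$\left( \frac{1}{w(Q)}\int_Q \left( \frac{Mf(x) - \operatorname{ess\,inf}_{Q} Mf }{M^\# f(x)} \right)^p w(x)\,dx\right)^{1/p} \le c_n [w]_{A_\infty}\, p,$$ where $c_n>0$ depends only on $n$. (2) Assume that there is a constant $C$ such that the estimate $$\left( \frac{1}{w(Q)}\int_Q \left( \frac{Mf(x) - \operatorname{ess\,inf}_{Q} Mf }{M^\# f(x)} \right)^p w(x)\, dx\right)^{1/p} \le C\, p$$ holds for every nonconstant locally integrable function $f$ on $\mathbb{R}^n$ such that $Mf$ is not identically infinite, every $1\le p<\infty$, and every cube $Q$. Then $w\in A_\infty$ and $[w]_{A_\infty}\le c_n' C$, where $c_n'>0$ depends only on $n$.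
   Context: Cubes are cubes in $\mathbb{R}^n$ with sides parallel to the coordinate axes; $|E|$ is Lebesgue measure and $f_Q=\frac{1}{|Q|}\int_Q f$. ''Nonconstant'' means not almost everywhere equal to a constant. The (uncentered) Hardy–Littlewood maximal function is $Mf(x)=\sup_{Q\ni x}\frac{1}{|Q|}\int_Q |f(y)|\,dy$ and the sharp maximal function is $M^\# f(x)=\sup_{Q\ni x}\frac{1}{|Q|}\int_Q |f(y)-f_Q|\,dy$, the suprema being over all cubes $Q$ containing $x$. A weight is a locally integrable function $w$ with $w>0$ a.e.; $w(E)=\int_E w$. The Fujii–Wilson constant is $[w]_{A_\infty}=\sup_Q\frac{1}{w(Q)}\int_Q M(w\chi_Q)(x)\,dx$, the supremum over all cubes, and $w\in A_\infty$ means $[w]_{A_\infty}<\infty$. The essential infimum is with respect to Lebesgue measure. *)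

(* Defs.v *)
From HB Require Import structures.
From mathcomp Require Import all_boot all_order all_algebra.
From mathcomp Require Import all_classical all_reals all_analysis.

Set Implicit Arguments.
Unset Strict Implicit.
Unset Printing Implicit Defensive.

Import Order.TTheory GRing.Theory Num.Theory.
Import numFieldNormedType.Exports.

Local Open Scope classical_set_scope.
Local Open Scope ring_scope.

(* R^n with its Borel sigma-algebra (the product sigma-algebra on tuples). *)
Notation vec R n := (n.-tuple (measurableTypeR R)).

Section lebesgue_measure_step.
Context {R : realType} (n : nat).
Variable m : {sigma_finite_measure set (vec R n) -> \bar R}.
Local Open Scope ereal_scope.

Definition vcons (x : measurableTypeR R * vec R n) : vec R n.+1 :=
  [tuple of x.1 :: x.2].

Definition vuncons (x : vec R n.+1) : measurableTypeR R * vec R n :=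
  (tnth x ord0, [tuple of behead x]).

Lemma vconsK : cancel vcons vuncons.
Proof.
case=> x y; rewrite /vcons /vuncons/=; congr pair.
by apply: val_inj.
Qed.

Lemma measurable_vcons : measurable_fun [set: _] vcons.
Proof. exact: measurable_cons. Qed.

Lemma measurable_vuncons : measurable_fun [set: _] vuncons.
Proof.
apply/measurable_fun_pair; first exact: measurable_tnth.
exact: measurable_behead.
Qed.

Definition lebesgue_step : set (vec R n.+1) -> \bar R :=
  pushforward (lebesgue_measure \x m) vcons.

Let lebesgue_step0 : lebesgue_step set0 = 0.
Proof. by rewrite /lebesgue_step /pushforward preimage_set0 measure0. Qed.

Let lebesgue_step_ge0 A : 0 <= lebesgue_step A.
Proof. have mf := measurable_vcons; exact: measure_ge0. Qed.

Let lebesgue_step_sigma_additive : semi_sigma_additive lebesgue_step.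
Proof.
have mf := measurable_vcons; exact: measure_semi_sigma_additive.
Qed.

HB.instance Definition _ := isMeasure.Build _ _ _ lebesgue_step
  lebesgue_step0 lebesgue_step_ge0 lebesgue_step_sigma_additive.

Let lebesgue_step_sigma_finite : sigma_finite [set: vec R n.+1] lebesgue_step.
Proof.
have /sigma_finiteP[F [TF ndF Foo]] := sigma_finiteT (@lebesgue_measure R).
have /sigma_finiteP[G [TG ndG Goo]] := sigma_finiteT m.
exists (fun k => vuncons @^-1` (F k `*` G k)).
  rewrite -preimage_bigcup; apply/esym/seteqP; split=> // x _.
  have [[i _ Fi] [j _ Gj]] : (\bigcup_k F k) (vuncons x).1 /\
      (\bigcup_k G k) (vuncons x).2 by rewrite -TF -TG.
  exists (maxn i j) => //; split.
  - by move: Fi; exact/subsetPset/ndF/leq_maxl.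
  - by move: Gj; exact/subsetPset/ndG/leq_maxr.
move=> k; have [mF Fk] := Foo k; have [mG Gk] := Goo k.
have mFG : measurable (F k `*` G k) by exact: measurableX.
split; first by rewrite -[X in measurable X]setTI; exact: measurable_vuncons.
rewrite /lebesgue_step /pushforward -comp_preimage.
rewrite (_ : vuncons \o vcons = id); last exact/funext/vconsK.
by rewrite preimage_id product_measure1E// lte_mul_pinfty// ge0_fin_numE.
Qed.

HB.instance Definition _ := Measure_isSigmaFinite.Build _ _ _ lebesgue_step
  lebesgue_step_sigma_finite.

End lebesgue_measure_step.

(* n-dimensional Lebesgue measure: the n-fold product of the one-dimensional
   one, transported from R * R^n to R^(n+1). *)
Fixpoint lebesgue_vec (R : realType) (n : nat) :
    {sigma_finite_measure set (vec R n) -> \bar R} :=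
  match n with
  | 0 => \d_ [tuple]
  | k.+1 => lebesgue_step (lebesgue_vec R k)
  end.

Section cubes.
Context {R : realType}.

Definition cube n (a : vec R n) (r : R) : set (vec R n) :=
  [set x | forall i, tnth a i <= tnth x i <= tnth a i + r].

Definition is_cube n (Q : set (vec R n)) := exists a r, 0 < r /\ Q = cube a r.

Lemma vcons_preimage_cube n (a : vec R n.+1) (r : R) :
  @vcons R n @^-1` cube a r =
  `[tnth a ord0, tnth a ord0 + r]%classic `*` cube (vuncons a).2 r.
Proof.
apply/seteqP; split => [[x y] H|[x y] [/= Hx Hy] i].
  split => [/=|i /=]; first by have := H ord0; rewrite /= in_itv.
  by have := H (lift ord0 i); rewrite !(tnth_nth 0)/= ?nth_behead.
case: (unliftP ord0 i) => [j ->|->]; last by move: Hx; rewrite /= in_itv.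
by have := Hy j; rewrite !(tnth_nth 0)/= ?nth_behead.
Qed.

Lemma measurable_cube n (a : vec R n) (r : R) : measurable (cube a r).
Proof.
have -> : cube a r = \bigcap_(i in [set: 'I_n])
    ((fun x : vec R n => tnth x i) @^-1` `[tnth a i, tnth a i + r]%classic).
  by apply/seteqP; split => x H i; have := H i; rewrite /= in_itv//; apply.
apply: fin_bigcap_measurable => // i _.
by rewrite -[X in measurable X]setTI; exact: measurable_tnth.
Qed.

Lemma lebesgue_vec_cube n (a : vec R n) (r : R) :
  0 <= r -> lebesgue_vec R n (cube a r) = (r ^+ n)%:E.
Proof.
move=> r0; elim: n a => [|n IH] a /=.
  rewrite diracE mem_set ?expr0//; by case.
rewrite /lebesgue_step /pushforward vcons_preimage_cube product_measure1E//.
- rewrite IH exprS EFinM; congr (_ * _)%E.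
  apply: (etrans (lebesgue_measure_itv `[tnth a ord0, tnth a ord0 + r])).
  rewrite /= lte_fin ltrDl; have [r_gt0|r_le0] := ltP 0 r.
    by rewrite -EFinB addrAC subrr add0r.
  by congr EFin; apply/eqP; rewrite eq_le r0 r_le0.
- exact: measurable_cube.
Qed.

End cubes.

Section sharp_maximal.
Context {R : realType} {n : nat}.
Local Notation mu := (lebesgue_vec R n).
Implicit Types (f w : vec R n -> R) (Q : set (vec R n)) (x : vec R n).
Local Open Scope ereal_scope.

(* The measurable sets of [lebesgue_vec] are the Borel sets; Lebesgue measurable
   functions are the functions that agree almost everywhere with a Borel one.
   No value is lost in the integrals of such functions: the integral of a
   nonnegative function is a supremum over the Borel simple functions below it,
   which is insensitive to a null set. *)
Definition lebesgue_measurable_fun f :=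
  exists2 g : vec R n -> R,
    measurable_fun setT g & {ae mu, forall x, f x = g x}.

(* Every compact set is contained in a cube. *)
Definition locally_integrable_vec f :=
  lebesgue_measurable_fun f /\
  forall Q, is_cube Q -> \int[mu]_(x in Q) `|f x|%:E < +oo.

Definition nonconstant f := ~ exists c : R, {ae mu, forall x, f x = c}.

Definition mean f Q : R := (\int[mu]_(y in Q) f y)%R / fine (mu Q).

Definition maximal f x : \bar R :=
  ereal_sup [set (\int[mu]_(y in Q) `|f y|%:E) / mu Q
            | Q in [set Q | is_cube Q /\ Q x]].

Definition sharp_maximal f x : \bar R :=
  ereal_sup [set (\int[mu]_(y in Q) `|f y - mean f Q|%:E) / mu Q
            | Q in [set Q | is_cube Q /\ Q x]].

Definition weight w :=
  locally_integrable_vec w /\ {ae mu, forall x, (0 < w x)%R}.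

Definition weight_of w Q : \bar R := \int[mu]_(x in Q) (w x)%:E.

Definition fujii_wilson w : \bar R :=
  ereal_sup [set (\int[mu]_(x in Q) maximal (w \_ Q) x) / weight_of w Q
            | Q in [set Q | is_cube Q]].

Definition A_infty w := fujii_wilson w < +oo.

(* The library's [ess_inf], relative to Q. *)
Definition ess_inf_on Q (g : vec R n -> \bar R) : \bar R :=
  ereal_sup [set y | {ae mu, forall x, Q x -> y <= g x}].

(* For nonconstant f with [maximal f] not identically +oo, [sharp_maximal f] is
   positive everywhere and [maximal f], [sharp_maximal f] are finite almost
   everywhere, so the conventions for extended real operations only act on a
   null set. *)
Definition ratio_norm w f Q (p : R) : \bar R :=
  ((\int[mu]_(x in Q)
      ((((maximal f x - ess_inf_on Q (maximal f)) / sharp_maximal f x) `^ p)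
        * (w x)%:E))
    / weight_of w Q) `^ p^-1.

End sharp_maximal.

(* Main.v *)
Require Import Defs.
From mathcomp Require Import all_boot all_order all_algebra.
From mathcomp Require Import all_classical all_reals all_analysis measurable_realfun.
From mathcomp Require Import lra ring.

Set Implicit Arguments.
Unset Strict Implicit.
Unset Printing Implicit Defensive.

Import Order.TTheory GRing.Theory Num.Theory.
Import numFieldNormedType.Exports.

Local Open Scope classical_set_scope.
Local Open Scope ring_scope.
Local Open Scope ereal_scope.

(** Why the theorem holds.

    Write c for step_constant, M f for the maximal function, M# f for the sharp
    one, m_T for the essential infimum of M f on a cube T, [w] for the
    Fujii-Wilson constant.

    Sufficiency.  Let x lie in T.  A cube S through x that is at least as large
    as T has a triple containing T, so the average of |f| on S exceeds m_T by at
    most 3^n inf_T M# f.  A smaller cube lies in the triple 3T, and there the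
    average exceeds m_T by at most M((f - f_{3T}) 1_{3T})(x)
    ([maximal_localize]).  By the weak type (1,1) inequality, the set where M f
    exceeds m_T + c inf_T M# f fills at most the fraction 2^-(n+2) of T
    ([large_maximal_small]).  Cover it by the maximal dyadic subcubes P of T in
    which it has density above 2^-(n+1): they fill at most half of T, and none
    of them is filled by the set, so m_P <= m_T + c inf_T M# f
    ([dyadic_stopping], [exists_stopping_family]).  Repeating this inside every
    P yields nested generations, and outside the k-th one
    M f <= m_T + k c M# f ([maximal_outside_generation]).

    Since half of each cube survives when its children are removed, the weights
    w(P) of all cubes of all generations add up to at most
    2 int_Q M(w 1_Q) <= 2 [w] w(Q) ([carleson]); the same bound inside every
    cube says that each tail of the sequence of weights of generations is at
    most L = 2 [w] times its first term.  Such a sequence decays geometrically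
    with ratio 1 + 1/(2L) ([geometric_sum]), and
    k^p <= (3 L p)^p (1 + 1/(2L))^k, which gives an L^p norm of order [w] p
    ([sufficiency_borel]).

    Necessity.  Apply the estimate with p = 1.  For h >= 0 of finite mass consider the
    truncated discrete logarithm f_N = sum_{k < N} 1_{M h > t 2^k}.  As for
    log M h in the theorem of Coifman and Rochberg, M# f_N is bounded by a
    dimensional constant B uniformly in N ([sharp_maximal_staircase]), the
    essential infimum of M f_N on Q is at most a dimensional A
    ([ess_inf_maximal_staircase]), and f_N <= M f_N because f_N is lower
    semicontinuous ([staircase_le_maximal]).  The assumed estimate thus bounds
    int_Q (f_N - A)^+ w by B C w(Q) ([staircase_excess]).  Take h = w 1_Q.  Then
    M h <= t + sum_k t 2^k 1_{M h > t 2^k}, and the weak type inequality in the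
    form t 2^k |{M h > t 2^k}| <= 3^n int_{M h > t 2^k} h turns the integral of
    this into int_Q f_N w, so [w] <= 1/2 + 3^n (A + B C)
    ([fujii_wilson_le]).  The additive constant is absorbed because C is bounded
    below: take for h the indicator of a small dyadic subcube of Q carrying at
    least half of its fair share of w(Q) ([constant_ge]).

    Functions enter only through their integrals, so f and w may be replaced by
    Borel representatives. *)

(** * Integrals of arbitrary functions *)
Section integral_nonmeasurable.
Context d (T : measurableType d) (R : realType).
Variable mu : {measure set T -> \bar R}.
Implicit Types (D : set T) (f g : T -> \bar R).
Import HBNNSimple.

(** The integral of a nonnegative function is the supremum of the integrals of
    the simple functions below it; cutting a simple function off on a null set
    does not change its integral.  This form integrates the quotient of M f by
    M# f without discussing its measurability. *)
Lemma ae_ge0_le_integral_all D f g :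
  (forall x, D x -> 0 <= f x) -> (forall x, D x -> 0 <= g x) ->
  {ae mu, forall x, D x -> f x <= g x} ->
  \int[mu]_(x in D) f x <= \int[mu]_(x in D) g x.
Proof.
move=> f0 g0 [N [mN N0 fgN]]; rewrite !ge0_integralE//=.
apply: ge_ereal_sup => _ [h /= hf <-].
have mC : measurable (~` N) by exact: measurableC.
have -> : sintegral mu h = sintegral mu (proj_nnsfun h mC).
  rewrite -(integralT_nnsfun mu h).
  rewrite (ge0_negligible_integral mN)//; last 2 first.
  - exact/measurable_EFinP.
  - by move=> x _; rewrite lee_fin.
  rewrite setTD integral_nnsfun//; apply: eq_sintegral => x.
  by rewrite /= mindicE patchE; case: (x \in ~` N); rewrite ?mulr1 ?mulr0.
apply: ereal_sup_ubound; exists (proj_nnsfun h mC) => //= x.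
rewrite mindicE; case: (boolP (x \in ~` N)) => [xN|xN].
  rewrite mulr1; apply: (le_trans (hf x)); rewrite !patchE.
  case: ifPn => // /set_mem Dx; apply: contrapT => fgx.
  by move/set_mem : xN; apply; apply: fgN => /= /(_ Dx).
by rewrite mulr0 patchE; case: ifPn => // /set_mem /g0.
Qed.

Lemma ae_eq_integral_all D f g : ae_eq mu D f g ->
  \int[mu]_(x in D) f x = \int[mu]_(x in D) g x.
Proof.
move=> fg; rewrite [LHS]integralE [RHS]integralE; congr (_ - _);
  by apply/eqP; rewrite eq_le; apply/andP; split;
    apply: ae_ge0_le_integral_all => //;
    apply: filterS fg => x /[apply] fgx; rewrite ?funeposE ?funenegE fgx.
Qed.

End integral_nonmeasurable.

(** * Cubes *)
Section cube_geometry.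
Context {R : realType} {n : nat}.
Local Notation mu := (lebesgue_vec R n).
Implicit Types (a b x : vec R n) (r s : R).

Definition half_open_cube a r : set (vec R n) :=
  [set x | forall i, (tnth a i <= tnth x i < tnth a i + r)%R].

Definition triple_corner a r : vec R n :=
  mktuple (fun i : 'I_n => (tnth a i - r)%R).

Definition triple a r := cube (triple_corner a r) (3 * r).

Lemma half_open_cube_sub a r : half_open_cube a r `<=` cube a r.
Proof. by move=> x ax i; have /andP[-> /ltW] := ax i. Qed.

Lemma measurable_half_open_cube a r : measurable (half_open_cube a r).
Proof.
have -> : half_open_cube a r = \bigcap_(i in [set: 'I_n])
    ((fun x : vec R n => tnth x i) @^-1` `[tnth a i, (tnth a i + r)%R[%classic).
  by apply/seteqP; split => x H i; have := H i; rewrite /= in_itv//; apply.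
apply: fin_bigcap_measurable => // i _.
by rewrite -[X in measurable X]setTI; exact: measurable_tnth.
Qed.

Lemma expr_lt_right (l : R) r (c : R) : (l * r ^+ n < c)%R ->
  exists e : R, (0 < e)%R /\ (l * (r + e) ^+ n < c)%R.
Proof.
move=> rc; have : nbhs r [set x : R | (l * x ^+ n < c)%R].
  have cv : (l * x ^+ n)%R @[x --> r] --> (l * r ^+ n)%R.
    by apply: cvgM; [exact: cvg_cst|exact: exprn_continuous].
  exact: (cvgr_lt _ cv).
move=> /nbhs_ballP[e /= e0 He]; exists (e / 2)%R; split; first by rewrite divr_gt0.
apply: He; rewrite /ball /= opprD addrA subrr sub0r normrN gtr0_norm ?divr_gt0//.
by rewrite ltr_pdivrMr// ltr_pMr// ltr1n.
Qed.

Lemma expr_gt_left r (c : R) : (0 < r)%R -> (c < r ^+ n)%R ->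
  exists e : R, [/\ (0 < e)%R, (e < r)%R & (c < (r - e) ^+ n)%R].
Proof.
move=> r0 rc; have : nbhs r [set x : R | (c < x ^+ n)%R].
  exact: (cvgr_gt _ (@exprn_continuous R n r)).
move=> /nbhs_ballP[e /= e0 He]; exists (Num.min e r / 2)%R.
have m0 : (0 < Num.min e r)%R by rewrite lt_min e0.
split; first by rewrite divr_gt0.
  rewrite ltr_pdivrMr// (@le_lt_trans _ _ r)// ?ge_min ?lexx ?orbT//.
  by rewrite ltr_pMr// ltr1n.
apply: He; rewrite /ball /= opprB addrC subrK gtr0_norm ?divr_gt0//.
rewrite ltr_pdivrMr// (@le_lt_trans _ _ e)// ?ge_min ?lexx ?orbT//.
by rewrite ltr_pMr// ltr1n.
Qed.

(** Slightly smaller closed cubes with the same corner lie inside, and r ^+ n is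
    continuous in r. *)
Lemma lebesgue_half_open_cube a r : (0 < r)%R ->
  mu (half_open_cube a r) = (r ^+ n)%:E.
Proof.
move=> r0; apply/eqP; rewrite eq_le; apply/andP; split.
  rewrite -(lebesgue_vec_cube a (ltW r0)).
  by apply: le_measure; rewrite ?inE;
    [exact: measurable_half_open_cube|exact: measurable_cube|
     exact: half_open_cube_sub].
rewrite leNgt; apply/negP => lt.
have fin : mu (half_open_cube a r) \is a fin_num.
  by rewrite ge0_fin_numE// (lt_trans lt)// ltry.
move: lt; rewrite -(fineK fin) lte_fin => /(expr_gt_left r0)[e [e0 er]].
rewrite -lte_fin fineK// -(@lebesgue_vec_cube _ _ a); last by rewrite subr_ge0 ltW.
rewrite ltNge => /negP; apply; apply: le_measure; rewrite ?inE.
- exact: measurable_cube.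
- exact: measurable_half_open_cube.
- move=> x ax i; have /andP[-> /=] := ax i; move=> /le_lt_trans; apply.
  by rewrite addrA gtrBl.
Qed.

Lemma lebesgue_cube_boundary a r : (0 < r)%R ->
  mu (cube a r `\` half_open_cube a r) = 0.
Proof.
move=> r0; have mC := measurable_cube a r.
have mH := measurable_half_open_cube a r.
rewrite measureD//; last by rewrite [X in X < _]lebesgue_vec_cube ?ltry// ltW.
rewrite setIidr; last exact: half_open_cube_sub.
rewrite -(@subee _ (r ^+ n)%:E)//; congr (_ - _).
  exact: (lebesgue_vec_cube a (ltW r0)).
exact: lebesgue_half_open_cube.
Qed.

Lemma ae_half_open_cube a r : (0 < r)%R ->
  {ae mu, forall x, cube a r x -> half_open_cube a r x}.
Proof.
move=> r0; exists (cube a r `\` half_open_cube a r); split.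
- by apply: measurableD; [exact: measurable_cube|exact: measurable_half_open_cube].
- exact: lebesgue_cube_boundary.
- by move=> x /= /not_implyP.
Qed.

Lemma ge0_integral_half_open_cube a r (g : vec R n -> \bar R) : (0 < r)%R ->
  measurable_fun setT g -> (forall x, 0 <= g x) ->
  \int[mu]_(x in cube a r) g x = \int[mu]_(x in half_open_cube a r) g x.
Proof.
move=> r0 mg g0; have mC := measurable_cube a r.
rewrite (@ge0_negligible_integral _ _ _ _ _ (cube a r `\` half_open_cube a r))//.
- by rewrite setDD setIidr//; exact: half_open_cube_sub.
- by apply: measurableD => //; exact: measurable_half_open_cube.
- exact: measurable_funS mg.
- exact: lebesgue_cube_boundary.
Qed.

(** The source of every localization below: of two cubes that meet, the triple of
    the larger one contains the smaller one. *)
Lemma cube_sub_triple a b x r s : cube a r x -> cube b s x -> (s <= r)%R ->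
  cube b s `<=` triple a r.
Proof.
move=> ax bx sr y bys i; rewrite tnth_mktuple.
have /andP[? ?] := ax i; have /andP[? ?] := bx i; have /andP[? ?] := bys i.
apply/andP; split; lra.
Qed.

Lemma lebesgue_triple a r : (0 <= r)%R -> mu (triple a r) = (3 ^+ n * r ^+ n)%:E.
Proof. by move=> r0; rewrite [LHS]lebesgue_vec_cube ?exprMn// mulr_ge0. Qed.

Lemma cube_sub_triple_self a r : (0 <= r)%R -> cube a r `<=` triple a r.
Proof. by move=> r0 x ax; exact: (cube_sub_triple ax ax). Qed.

End cube_geometry.

Section boxes.
Context {R : realType} {n : nat}.
Local Notation mu := (lebesgue_vec R n).
Local Notation box := (vec R n * R)%type.
Implicit Types p : box.

(** Cubes are handled through their corner and side.  Closed cubes are those of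
    the maximal functions; half-open ones are used where exact partitions are
    needed, a side 0 then encoding the empty cube. *)
Definition box_set p : set (vec R n) := cube p.1 p.2.

Definition half_open_box p : set (vec R n) := half_open_cube p.1 p.2.

Lemma measurable_box_set p : measurable (box_set p).
Proof. exact: measurable_cube. Qed.

Lemma measurable_half_open_box p : measurable (half_open_box p).
Proof. exact: measurable_half_open_cube. Qed.

Lemma lebesgue_box_set p : (0 <= p.2)%R -> mu (box_set p) = (p.2 ^+ n)%:E.
Proof. exact: lebesgue_vec_cube. Qed.

Hypothesis n_gt0 : (0 < n)%N.

Lemma half_open_box_empty p : p.2 = 0%R -> half_open_box p = set0.
Proof.
case: p => a r /= ->; apply/seteqP; split=> // x ax; have := ax (Ordinal n_gt0).
by rewrite /= addr0 => /andP[+ /le_lt_trans] => /[swap] /[apply]; rewrite ltxx.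
Qed.

Lemma lebesgue_half_open_box p : (0 <= p.2)%R ->
  mu (half_open_box p) = (p.2 ^+ n)%:E.
Proof.
rewrite le_eqVlt => /predU1P[/esym p0|p0]; last exact: lebesgue_half_open_cube.
by rewrite (half_open_box_empty p0) measure0 p0 expr0n gtn_eqF.
Qed.

End boxes.

(** * The Vitali covering argument *)
Section vitali.
Context {R : realType} {n : nat}.
Local Notation mu := (lebesgue_vec R n).
Local Notation box := (vec R n * R)%type.
Implicit Types (p q : box) (s t : seq box).

Lemma largest_box s p : p \in s ->
  exists2 q, q \in s & forall p', p' \in s -> (p'.2 <= q.2)%R.
Proof.
elim: s p => // a [|b s] IH p _.
  by exists a => [|p']; rewrite !inE// => /eqP ->.
have [q qs qmax] := IH b (mem_head _ _).
have [aq|qa] := leP a.2 q.2.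
  exists q => [|p']; first by rewrite inE qs orbT.
  by rewrite inE => /predU1P[->//|/qmax].
exists a => [|p']; first by rewrite mem_head.
by rewrite inE => /predU1P[->//|/qmax /le_trans]; apply; exact: ltW.
Qed.

(** Greedy choice: keep a cube of largest side, discard the cubes that meet it
    (its triple contains them) and continue with the others. *)
Lemma vitali_finite s : (forall p, p \in s -> (0 < p.2)%R) ->
  exists t, [/\ {subset t <= s}, uniq t, trivIset [set` t] box_set &
    forall p, p \in s ->
      exists2 q, q \in t & box_set p `<=` triple q.1 q.2].
Proof.
have [k] := ubnP (size s); elim: k s => // k IH s sk s0.
case: s sk s0 => [_ _|p0 s0 sk s_gt0]; first by exists [::]; split=> // p q.
set s := p0 :: s0 in sk s_gt0 *.
have [q qs qmax] := largest_box (mem_head p0 s0).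
pose s' := [seq p <- s | `[< box_set p `&` box_set q = set0 >]].
have s's : {subset s' <= s} by move=> p; rewrite mem_filter => /andP[].
have qs' : q \notin s'.
  rewrite mem_filter qs andbT; apply/negP => /asboolP /seteqP[H _].
  apply: (H q.1); split=> i; rewrite lexx lerDl ltW//; exact: s_gt0.
have s'k : (size s' < k)%N.
  rewrite -ltnS (leq_trans _ sk)// ltnS.
  rewrite size_filter -(count_predC (fun p => `[< box_set p `&` box_set q = set0 >]) s).
  rewrite -addn1 leq_add2l -has_count; apply/hasP; exists q => //=.
  by move: qs'; rewrite mem_filter qs andbT.
have [t [ts' ut tt cov]] := IH s' s'k (fun p ps' => s_gt0 p (s's p ps')).
have disj p : p \in t -> box_set p `&` box_set q = set0.
  by move=> /ts'; rewrite mem_filter => /andP[/asboolP].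
exists (q :: t); split.
- by move=> p; rewrite inE => /predU1P[->//|/ts' /s's].
- by rewrite /= ut andbT; apply: contra qs'; exact: ts'.
- move=> p p' /=; rewrite !inE => /predU1P[->|pt] /predU1P[->|p't]//.
  + by rewrite setIC disj// => -[].
  + by rewrite disj// => -[].
  + exact: tt.
- move=> p ps; have [pq|pq] := pselect (box_set p `&` box_set q = set0).
    have [|r rt pr] := cov p; first by rewrite mem_filter ps andbT; exact/asboolP.
    by exists r => //; rewrite inE rt orbT.
  exists q; first exact: mem_head.
  move/eqP/set0P : pq => [x [px qx]].
  exact: (cube_sub_triple qx px (qmax _ ps)).
Qed.

Lemma measure_le_sum_cover (A : set (vec R n)) (I : eqType) (F : I -> set (vec R n)) (t : seq I) :
  measurable A -> (forall i, measurable (F i)) ->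
  (forall x, A x -> exists2 i, i \in t & F i x) ->
  mu A <= \sum_(i <- t) mu (F i).
Proof.
move=> mA mF; elim: t A mA => [|p t IH] A mA At.
  rewrite big_nil (_ : A = set0) ?measure0//.
  by apply/seteqP; split=> // x /At [].
rewrite big_cons; apply: (@le_trans _ _ (mu (F p `|` (A `\` F p)))).
  apply: le_measure; rewrite ?inE//.
    by apply: measurableU => //; exact: measurableD.
  by move=> x Ax; have [?|?] := pselect (F p x); [left|right].
apply: (le_trans (measureU2 _ _ _)) => //; first exact: measurableD.
apply: leeD2l; apply: IH => [|x [Ax npx]]; first exact: measurableD.
by have [q] := At _ Ax; rewrite inE => /predU1P[->//|qt ?]; exists q.
Qed.

Variables (g : vec R n -> \bar R) (mg : measurable_fun setT g).
Hypothesis g0 : forall x, 0 <= g x.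
Variables (l : R) (l0 : (0 <= l)%R) (U : set (vec R n)) (mU : measurable U).

Let heavy p := l%:E * mu (box_set p) <= \int[mu]_(x in box_set p) g x.

(** On the disjoint subfamily the lower bounds of the integrals add up, while its
    triples cover everything. *)
Lemma vitali_weak_finite s : (forall p, p \in s -> (0 < p.2)%R) ->
  (forall p, p \in s -> heavy p) -> (forall p, p \in s -> box_set p `<=` U) ->
  l%:E * mu (\bigcup_(p in [set` s]) box_set p) <=
    (3 ^+ n)%:E * \int[mu]_(x in U) g x.
Proof.
move=> s0 sh sU; have [t [ts ut tt cov]] := vitali_finite s0.
have mS : measurable (\bigcup_(p in [set` s]) box_set p).
  by rewrite bigcup_seq; apply: bigsetU_measurable => p _; exact: measurable_cube.
apply: (@le_trans _ _ (\sum_(p <- t) l%:E * mu (triple p.1 p.2))).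
  rewrite -ge0_sume_distrr//; apply: lee_wpmul2l; first by rewrite lee_fin.
  apply: (@measure_le_sum_cover _ _ (fun p => triple p.1 p.2)) => //.
    by move=> p; exact: measurable_cube.
  by move=> x [p /= /cov[q qt pq] /pq xq]; exists q.
apply: (@le_trans _ _ (\sum_(p <- t) (3 ^+ n)%:E * \int[mu]_(x in box_set p) g x)).
  rewrite big_seq [leRHS]big_seq; apply: lee_sum => p pt.
  have r0 : (0 <= p.2)%R by apply/ltW/s0/ts.
  rewrite lebesgue_triple// EFinM muleCA; apply: lee_wpmul2l.
    by rewrite lee_fin exprn_ge0.
  rewrite -(lebesgue_vec_cube p.1 r0); exact/sh/ts.
rewrite -ge0_sume_distrr; last by move=> p _; apply: integral_ge0.
apply: lee_wpmul2l; first by rewrite lee_fin exprn_ge0.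
rewrite -ge0_integral_bigsetU//=; first 1 last.
- exact: measurable_box_set.
- exact: measurable_funS mg.
apply: ge0_subset_integral => //.
- by apply: bigsetU_measurable => p _; exact: measurable_box_set.
- exact: measurable_funS mg.
- by rewrite -bigcup_seq => x [p /= /ts /sU pU /pU].
Qed.

(** Monotone limit of the finite case; the total measure may be infinite. *)
Lemma vitali_weak (B : nat -> box) (P : set nat) :
  (forall k, P k -> (0 < (B k).2)%R) ->
  (forall k, P k -> heavy (B k)) -> (forall k, P k -> box_set (B k) `<=` U) ->
  l%:E * mu (\bigcup_(k in P) box_set (B k)) <=
    (3 ^+ n)%:E * \int[mu]_(x in U) g x.
Proof.
move=> B0 Bh BU.
pose s k := [seq B i | i <- iota 0 k & `[< P i >]].
pose F k := \bigcup_(p in [set` s k]) box_set p.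
have sP k p : p \in s k -> exists2 i, P i & p = B i.
  by move=> /mapP[i]; rewrite mem_filter => /andP[/asboolP Pi _] ->; exists i.
have mF k : measurable (F k).
  by rewrite /F bigcup_seq; apply: bigsetU_measurable => p _; exact: measurable_cube.
have FE : \bigcup_k F k = \bigcup_(k in P) box_set (B k).
  apply/seteqP; split => x [k].
    by move=> _ [p /= /sP[i Pi ->]]; exists i.
  move=> Pk Bx; exists k.+1 => //; exists (B k) => //=.
  by apply: map_f; rewrite mem_filter mem_iota/= add0n ltnSn andbT; exact/asboolP.
rewrite -FE.
have : (l%:E * (mu \o F) k)%E @[k --> \oo] --> l%:E * mu (\bigcup_k F k).
  apply: cvgeZl => //; apply: nondecreasing_cvg_mu => //.
    exact: bigcup_measurable.
  move=> i j ij; apply/subsetPset => x [p /= /mapP[a]].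
  rewrite mem_filter mem_iota add0n /= => /andP[Pa ai] -> xp.
  exists (B a) => //=; apply: map_f.
  by rewrite mem_filter Pa mem_iota add0n /= (leq_trans ai).
move=> cv; rewrite -(cvg_lim _ cv)//; apply: lime_le; first by apply/cvgP: cv.
apply: nearW => k; apply: vitali_weak_finite => p /sP[i Pi ->].
- exact: B0. - exact: Bh. - exact: BU.
Qed.

End vitali.

(** * The maximal function *)
Section maximal_function.
Context {R : realType} {n : nat}.
Local Notation mu := (lebesgue_vec R n).
Local Notation box := (vec R n * R)%type.
Implicit Types (p q : box) (x y : vec R n) (g : vec R n -> \bar R).

(** The maximal function of a nonnegative extended-real function, so that
    maximal f is by definition that of the absolute value of f and the operator
    also applies to restrictions and deviations. *)
Definition emaximal g x : \bar R :=
  ereal_sup [set (\int[mu]_(y in Q) g y) / mu Q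
            | Q in [set Q | is_cube Q /\ Q x]].

(** Openness for the sup norm. *)
Definition sup_open (A : set (vec R n)) := forall x, A x ->
  exists2 e : R, (0 < e)%R &
    forall y, (forall i, `|tnth y i - tnth x i| < e)%R -> A y.

Lemma lte_average (a : vec R n) (r : R) (l : R) (I : \bar R) : (0 < r)%R ->
  (l%:E < I / mu (cube a r)) = ((l * r ^+ n)%:E < I).
Proof.
move=> r0; rewrite lebesgue_vec_cube ?(ltW r0)// inver gt_eqF ?exprn_gt0//.
by rewrite lte_pdivlMr ?exprn_gt0// EFinM.
Qed.

Lemma emaximal_gtP g x (l : R) : l%:E < emaximal g x <->
  exists2 p, [/\ (0 < p.2)%R & box_set p x] &
    (l * p.2 ^+ n)%:E < \int[mu]_(y in box_set p) g y.
Proof.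
split=> [/ereal_sup_gt[_ [_ [[a [r [r0 ->]]] ax] <-]]|[[a r] /= [r0 ax]]].
  by rewrite lte_average// => lt; exists (a, r).
rewrite /box_set/= -(lte_average a)// => /lt_le_trans; apply.
by apply: ereal_sup_ubound; exists (cube a r) => //; split=> //; exists a, r.
Qed.

Lemma average_le_emaximal g x p : (0 < p.2)%R -> box_set p x ->
  (\int[mu]_(y in box_set p) g y) / mu (box_set p) <= emaximal g x.
Proof.
by move=> p0 px; apply: ereal_sup_ubound; exists (box_set p) => //; split=> //;
  exists p.1, p.2.
Qed.

Lemma emaximal_ge0 g x : (forall y, 0 <= g y) -> 0 <= emaximal g x.
Proof.
move=> g0; have px : box_set (x, 1%R) x.
  by move=> i /=; rewrite lexx lerDl ler01.
apply: le_trans (average_le_emaximal g _ px) => //.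
by apply: mule_ge0; [exact: integral_ge0|rewrite inve_ge0].
Qed.

(** An enumeration of the cubes with rational corner and side; the indices that
    code no cube get the side 0, which heavy_box excludes. *)
Definition rational_box (k : nat) : box :=
  if unpickle k is Some i
  then (map_tuple (fun q : rat => ratr q : measurableTypeR R)
          (i : n.-tuple rat * rat).1, ratr i.2)
  else (nseq_tuple n (0%R : measurableTypeR R), 0%R).

(** A cube can be enlarged to a rational one that contains it in its interior,
    at an arbitrarily small cost in volume. *)
Lemma rational_box_approx p (l c : R) x : (0 < p.2)%R -> box_set p x ->
  (l * p.2 ^+ n < c)%R -> exists k, let q := rational_box k in
    [/\ (0 < q.2)%R, box_set p `<=` box_set q, (l * q.2 ^+ n < c)%R &
      exists2 e : R, (0 < e)%R &
        forall y, (forall i, `|tnth y i - tnth x i| < e)%R -> box_set q y].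
Proof.
case: p => a r /= r0 ax lc; have [e [e0 He]] := expr_lt_right lc.

(* The corner moves by less than 2h to the left and the side grows by at least
   3h, so that a margin h remains on both sides. *)
pose h := (e / 4)%R; have h0 : (0 < h)%R by rewrite divr_gt0.
have /choice[f Hf] i : exists q : rat,
    (tnth a i - h * 2 < ratr q < tnth a i - h)%R.
  have [|q] := @rat_in_itvoo R (tnth a i - h * 2)%R (tnth a i - h)%R.
    by rewrite ltrD2l ltrN2; lra.
  by rewrite in_itv/= => ?; exists q.
have [|s] := @rat_in_itvoo R (r + 3 * h)%R (r + 4 * h)%R; first by lra.
rewrite in_itv/= => /andP[rs sr].
pose i0 : n.-tuple rat * rat := (mktuple f, s).
have E : rational_box (pickle i0) =
    (map_tuple (fun q : rat => ratr q : measurableTypeR R) (mktuple f), ratr s).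
  by rewrite /rational_box pickleK.
exists (pickle i0); rewrite E /box_set/=.
have tE i : tnth (map_tuple (fun q : rat => ratr q : measurableTypeR R)
    (mktuple f)) i = ratr (f i) by rewrite tnth_map tnth_mktuple.
have eh : (4 * h = e)%R by rewrite /h; lra.
split; first by lra.
- move=> y ay i; have /andP[? ?] := ay i; have /andP[? ?] := Hf i.
  by rewrite tE; apply/andP; split; lra.
- have [l0|l0] := leP 0%R l.
    apply: le_lt_trans He; rewrite ler_wpM2l// lerXn2r ?nnegrE; lra.
  apply: le_lt_trans lc; rewrite ler_wnM2l ?(ltW l0)// lerXn2r ?nnegrE; lra.
- exists h => // y xy i; rewrite tE.
  have /andP[/= ? ?] := ax i; have /andP[? ?] := Hf i.
  by have := xy i; rewrite ltr_norml => /andP[? ?]; apply/andP; split; lra.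
Qed.

Section superlevel_sets.
Variables (g : vec R n -> \bar R) (mg : measurable_fun setT g).
Hypothesis g0 : forall x, 0 <= g x.
Implicit Type l : R.

Definition heavy_box l p :=
  (0 < p.2)%R /\ (l * p.2 ^+ n)%:E < \int[mu]_(y in box_set p) g y.

Lemma heavy_box_sub l p : heavy_box l p ->
  box_set p `<=` [set x | l%:E < emaximal g x].
Proof. by move=> [p0 lp] x px; apply/emaximal_gtP; exists p. Qed.

Lemma heavy_rational_box l x : l%:E < emaximal g x ->
  exists2 k, heavy_box l (rational_box k) &
    exists2 e : R, (0 < e)%R &
      forall y, (forall i, `|tnth y i - tnth x i| < e)%R ->
        box_set (rational_box k) y.
Proof.
move=> /emaximal_gtP[p [p0 px] lp].
have [c lc cI] : exists2 c : R, (l * p.2 ^+ n < c)%R &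
    c%:E <= \int[mu]_(y in box_set p) g y.
  move: lp; case: (\int[mu]_(y in box_set p) g y) => [c| |]//.
    by rewrite lte_fin => lc; exists c.
  by move=> _; exists (l * p.2 ^+ n + 1)%R; rewrite ?leey// ltrDl.
have [k [k0 pk lk ek]] := rational_box_approx p0 px lc.
exists k => //; split => //; rewrite -lte_fin in lk.
apply: (lt_le_trans lk); apply: (le_trans cI).
apply: ge0_subset_integral => //; try exact: measurable_box_set.
exact: measurable_funS mg.
Qed.

(** Countability of the rational cubes makes superlevel sets measurable and
    brings them within reach of the countable covering argument. *)
Lemma emaximal_superlevelE l : [set x | l%:E < emaximal g x] =
  \bigcup_(k in [set k | heavy_box l (rational_box k)]) box_set (rational_box k).
Proof.
apply/seteqP; split => [x /heavy_rational_box[k hk [e e0 He]]|x [k hk]].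
  by exists k => //; apply: He => i; rewrite subrr normr0.
exact: heavy_box_sub.
Qed.

Lemma measurable_superlevel l : measurable [set x | l%:E < emaximal g x].
Proof.
rewrite emaximal_superlevelE; apply: bigcup_measurable => k _.
exact: measurable_box_set.
Qed.

Lemma open_superlevel l : sup_open [set x | l%:E < emaximal g x].
Proof.
move=> x /heavy_rational_box[k hk [e e0 He]].
by exists e => // y /He; exact: heavy_box_sub.
Qed.

Lemma measurable_emaximal : measurable_fun setT (emaximal g).
Proof.
apply: (measurability _ (ErealGenOInfty.measurableE R)) => _ [_ [l ->] <-].
rewrite setTI (_ : _ @^-1` _ = [set x | l%:E < emaximal g x]).
  exact: measurable_superlevel.
by apply/seteqP; split=> x /=; rewrite in_itv/= andbT.
Qed.

(** Every cube of the covering lies in the superlevel set, which is why the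
    integral on the right can be restricted to that set; the necessity part
    depends on this localized form. *)
Lemma weak_type_superlevel l : (0 <= l)%R ->
  l%:E * mu [set x | l%:E < emaximal g x] <=
    (3 ^+ n)%:E * \int[mu]_(x in [set x | l%:E < emaximal g x]) g x.
Proof.
move=> l0; rewrite {1}emaximal_superlevelE; apply: vitali_weak => //.
- exact: measurable_superlevel.
- by move=> k [].
- move=> k [k0 /ltW]; apply: le_trans.
  by rewrite EFinM lebesgue_box_set // ltW.
- by move=> k hk; exact: heavy_box_sub.
Qed.

Lemma weak_type l : (0 <= l)%R ->
  l%:E * mu [set x | l%:E < emaximal g x] <= (3 ^+ n)%:E * \int[mu]_x g x.
Proof.
move=> l0; apply: (le_trans (weak_type_superlevel l0)).
apply: lee_wpmul2l; first by rewrite lee_fin exprn_ge0.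
by apply: ge0_subset_integral => //; exact: measurable_superlevel.
Qed.

End superlevel_sets.

End maximal_function.

(** * Dyadic subcubes of a cube *)
Section dyadic_cells.
Context {R : realType} {n : nat}.
Local Notation mu := (lebesgue_vec R n).
Local Notation box := (vec R n * R)%type.
Variables (a : vec R n) (r : R) (r_gt0 : (0 < r)%R).
Implicit Types (x y : vec R n) (d : nat) (k : n.-tuple int).

Definition cell_side d : R := (r / 2 ^+ d)%R.

(** The level-d cell of x is the set of the points with the same integer index;
    the inclusion between cells of different levels then reduces to an equality
    of indices. *)
Definition cell_index d x : n.-tuple int :=
  mktuple (fun i : 'I_n => Num.floor ((tnth x i - tnth a i) / cell_side d)%R).

Definition cell_box d k : box :=
  (mktuple (fun i : 'I_n => (tnth a i + (tnth k i)%:~R * cell_side d)%R), cell_side d).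

Definition cell d x : set (vec R n) := half_open_box (cell_box d (cell_index d x)).

Lemma cell_side_gt0 d : (0 < cell_side d)%R.
Proof. by rewrite divr_gt0// exprn_gt0. Qed.

Lemma cell_sideS d : cell_side d = (2 * cell_side d.+1)%R.
Proof. by rewrite /cell_side exprS invfM; field; rewrite expf_neq0. Qed.

Lemma in_cell_box d k x : half_open_box (cell_box d k) x <-> cell_index d x = k.
Proof.
have s0 := cell_side_gt0 d.
have E k' i : (tnth (cell_box d k').1 i <= tnth x i < tnth (cell_box d k').1 i + cell_side d)%R =
    (Num.floor ((tnth x i - tnth a i) / cell_side d)%R == tnth k' i).
  rewrite tnth_mktuple floor_eq ler_pdivlMr// ltr_pdivrMr// intrD mulrDl mul1r.
  by rewrite lerBrDl ltrBlDl addrA.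
split=> [kx|<- i].
  apply: eq_from_tnth => i; rewrite tnth_mktuple; apply/eqP.
  by rewrite -E; exact: kx.
by apply: (etrans (E _ i)); rewrite tnth_mktuple eqxx.
Qed.

Lemma in_cell d x y : cell d x y <-> cell_index d y = cell_index d x.
Proof. exact: in_cell_box. Qed.

Lemma cell_self d x : cell d x x.
Proof. exact/in_cell. Qed.

Lemma measurable_cell d x : measurable (cell d x).
Proof. exact: measurable_half_open_cube. Qed.

Lemma lebesgue_cell d x : mu (cell d x) = (cell_side d ^+ n)%:E.
Proof. exact/lebesgue_half_open_cube/cell_side_gt0. Qed.

Lemma cell_close d x y : cell d x y -> forall i, (`|tnth y i - tnth x i| < cell_side d)%R.
Proof.
move=> xy i; have /andP[/= ? ?] := cell_self d x i; have /andP[/= ? ?] := xy i.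
by rewrite ltr_norml; apply/andP; split; lra.
Qed.

(** The integer part of t is determined by that of 2 t. *)
Lemma cell_index_coarser d x y :
  cell_index d.+1 x = cell_index d.+1 y -> cell_index d x = cell_index d y.
Proof.
move=> xy; apply: eq_from_tnth => i; rewrite !tnth_mktuple.
have s0 := cell_side_gt0 d.+1.
have half (z : vec R n) : ((tnth z i - tnth a i) / cell_side d.+1 =
    2 * ((tnth z i - tnth a i) / cell_side d) :> R)%R.
  by rewrite (cell_sideS d); field; rewrite gt_eqF.
have : tnth (cell_index d.+1 x) i = tnth (cell_index d.+1 y) i by rewrite xy.
rewrite !tnth_mktuple !half; set s := (_ / _)%R; set t := (_ / _)%R.
move=> /eqP; rewrite floor_eq => /andP[lo hi].
apply/eqP; rewrite floor_eq -floor_ge_int -floor_lt_int.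
have /andP[tlo thi] := floor_itv (2 * t)%R.
set m := Num.floor t; set m2 := Num.floor (2 * t)%R in lo hi tlo thi *.
have m1 : (2 * m <= m2)%R.
  by rewrite /m2 floor_ge_int intrM ler_pM2l//; exact: floor_le.
have m3 : (m2 < 2 * (m + 1))%R.
  by rewrite /m2 floor_lt_int intrM ltr_pM2l//; exact: floorD1_gt.
rewrite floor_ge_int floor_lt_int.
have {}m1 : ((2 * m)%:~R <= m2%:~R :> R)%R by rewrite ler_int.
have {}m3 : ((m2 + 1)%:~R <= (2 * (m + 1))%:~R :> R)%R by rewrite ler_int lezD1.
move: m1 m3 lo hi; rewrite !intrM !intrD => m1 m3 lo hi.
by apply/andP; split; lra.
Qed.

Lemma cell_index_le d d' x y : (d <= d')%N ->
  cell_index d' x = cell_index d' y -> cell_index d x = cell_index d y.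
Proof.
move=> /subnK <-; elim: (d' - d)%N => // e IH H.
by apply: IH; apply: cell_index_coarser.
Qed.

Lemma cell0E x : half_open_cube a r x -> cell 0 x = half_open_cube a r.
Proof.
have s0 : cell_side 0 = r by rewrite /cell_side expr0 divr1.
have E z : half_open_cube a r z <-> half_open_box (cell_box 0 (nseq_tuple n 0%R)) z.
  by split=> az i; have := az i; rewrite /= tnth_mktuple s0 tnth_nseq mul0r addr0.
move=> /E/in_cell_box ax; apply/seteqP; split=> y.
  by move=> /in_cell; rewrite ax => /in_cell_box/E.
by move=> /E/in_cell_box ay; apply/in_cell; rewrite ax.
Qed.

Lemma cell_le d d' x : (d <= d')%N -> cell d' x `<=` cell d x.
Proof. by move=> dd y /in_cell /(cell_index_le dd) /in_cell. Qed.

Lemma cell_sub d x : half_open_cube a r x -> cell d x `<=` half_open_cube a r.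
Proof. by move=> ax; rewrite -(cell0E ax); exact: cell_le. Qed.

Lemma cell_eq d x y : cell_index d x = cell_index d y -> cell d x = cell d y.
Proof. by move=> xy; rewrite /cell xy. Qed.

Lemma cell_side_small (e : R) : (0 < e)%R -> exists d, (cell_side d < e)%R.
Proof.
move=> e0; exists (Num.bound (r / e)); rewrite /cell_side ltr_pdivrMr ?exprn_gt0//.
by rewrite mulrC -ltr_pdivrMr//; apply: upper_nthrootP.
Qed.

Hypothesis n_gt0 : (0 < n)%N.
Local Notation T := (half_open_cube a r).

Let half_open_box0 : half_open_box (a, 0%R) = set0.
Proof. exact: half_open_box_empty. Qed.

(** A rule sel that chooses at most one level at every point, and depends at
    level d only on the cell, selects a disjoint countable family of cells.  It is
    used with the stopping rule and with the rule that fixes the level. *)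
Section selection.
Variable sel : nat -> vec R n -> Prop.
Hypothesis sel_cell : forall d x y,
  cell_index d x = cell_index d y -> sel d x -> sel d y.
Hypothesis sel_uniq : forall d d' x, sel d x -> sel d' x -> d = d'.

Let selected (q : nat * n.-tuple int) :=
  exists x, [/\ T x, cell_index q.1 x = q.2 & sel q.1 x].

Definition selected_box (j : nat) : box :=
  if pickle_inv j is Some q then
    if `[< selected q >] then cell_box q.1 q.2 else (a, 0%R)
  else (a, 0%R).

Variant selected_box_spec j : box -> Prop :=
| SelectedNone : selected_box_spec j (a, 0%R)
| SelectedCell d x of T x & sel d x & pickle_inv j = Some (d, cell_index d x) :
   selected_box_spec j (cell_box d (cell_index d x)).

Lemma selected_boxP j : selected_box_spec j (selected_box j).
Proof.
rewrite /selected_box; case E : (pickle_inv j) => [[d k]|]; last exact: SelectedNone.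
case: asboolP => [[x /= [Tx xk fx]]|_]; last exact: SelectedNone.
by rewrite -xk; apply: SelectedCell => //; rewrite E xk.
Qed.

Lemma selected_box_disjoint : trivIset setT (half_open_box \o selected_box).
Proof.
move=> j j' _ _ [y [/=]].
case: (selected_boxP j) => [|d x Tx fx Ej]; first by rewrite half_open_box0.
move=> /in_cell yx.
case: (selected_boxP j') => [|d' x' Tx' fx' Ej']; first by rewrite half_open_box0.
move=> /in_cell yx'.
have dd : d = d'.
  apply: (@sel_uniq _ _ y); first by apply: sel_cell fx; rewrite yx.
  by apply: sel_cell fx'; rewrite yx'.
subst d'; have K i := @pickle_invK (nat * n.-tuple int)%type i.
have := K j; rewrite Ej /= => <-; have := K j'; rewrite Ej' /= => <-.
by rewrite -yx yx'.
Qed.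

Lemma selected_box_sub j : half_open_box (selected_box j) `<=` T.
Proof.
case: (selected_boxP j) => [|d x Tx _ _]; first by rewrite half_open_box0.
exact: cell_sub.
Qed.

Lemma selected_box_cover d x : T x -> sel d x ->
  exists j, half_open_box (selected_box j) x.
Proof.
move=> Tx dx; exists (pickle (d, cell_index d x)).
rewrite /selected_box pickleK_inv asboolT; first exact: cell_self.
by exists x.
Qed.

End selection.

Section stopping.
Variables (G : set (vec R n)) (mG : measurable G) (oG : sup_open G).
Hypothesis small : mu (T `&` G) <= (2^-1 ^+ n.+2 * r ^+ n)%:E.

(** The threshold is twice the assumed global density of G, so that the selected
    cells fill at most half of T; it is 2^-n times 1/2, so that the parent of a
    selected cell, which is not dense, leaves half of its child outside G. *)
Definition dense d x := (2^-1 ^+ n.+1 * cell_side d ^+ n)%:E < mu (cell d x `&` G).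

Definition first_dense d x := dense d x /\ forall d', (d' < d)%N -> ~ dense d' x.

Lemma first_dense_cell d x y : cell_index d x = cell_index d y ->
  first_dense d x -> first_dense d y.
Proof.
move=> xy [dx fx]; split; first by rewrite /dense -(cell_eq xy).
move=> d' d'd; rewrite /dense -(cell_eq (cell_index_le (ltnW d'd) xy)).
exact: fx.
Qed.

Lemma first_dense_uniq d d' x : first_dense d x -> first_dense d' x -> d = d'.
Proof.
move=> [dx fx] [d'x f'x]; have [dd|dd|//] := ltngtP d d'.
  by case: (f'x _ dd).
by case: (fx _ dd).
Qed.

(** G is open, hence contains all sufficiently small cells around x. *)
Lemma exists_first_dense x : T x -> G x -> exists d, first_dense d x.
Proof.
move=> Tx Gx; have [e e0 He] := oG Gx.
have [d de] := cell_side_small e0.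
have dd : dense d x.
  rewrite /dense setIidl; last first.
    by move=> y /cell_close xy; apply: He => i; exact: lt_trans de.
  rewrite lebesgue_cell lte_fin gtr_pMl ?exprn_gt0 ?cell_side_gt0//.
  by rewrite exprn_ilt1// ?invr_ge0// invf_lt1// ltr1n.
have ex : exists d, `[< dense d x >] by exists d; exact/asboolP.
exists (ex_minn ex); case: ex_minnP => m /asboolP dm mmin; split=> // d' d'm /asboolP.
by move=> /mmin; rewrite leqNgt d'm.
Qed.

(** A Calderon-Zygmund decomposition of the indicator function of G. *)
Lemma dyadic_stopping : exists P : nat -> box,
  [/\ trivIset setT (half_open_box \o P),
      forall j, (0 <= (P j).2)%R /\ half_open_box (P j) `<=` T,
      T `&` G `<=` \bigcup_j half_open_box (P j),
      \sum_(j <oo) mu (half_open_box (P j)) <= (2^-1 * r ^+ n)%:E &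
      forall j, (0 < (P j).2)%R -> 0 < mu (half_open_box (P j) `\` G)].
Proof.
pose P := selected_box first_dense; exists P.
have mB := @measurable_half_open_box R n.
have triv : trivIset setT (half_open_box \o P).
  exact: (selected_box_disjoint first_dense_cell first_dense_uniq).
have subT j : half_open_box (P j) `<=` T := @selected_box_sub first_dense j.
split => //.
- move=> j; split=> //; rewrite /P; case: (selected_boxP first_dense j) => //= d x _ _ _.
  exact/ltW/cell_side_gt0.
- move=> x [Tx Gx]; have [d fx] := exists_first_dense Tx Gx.
  by have [j jx] := selected_box_cover Tx fx; exists j.
- apply: (@le_trans _ _ (\sum_(j <oo) (2 ^+ n.+1)%:E * mu (half_open_box (P j) `&` G))).
    apply: lee_nneseries => // j _.
    rewrite /P; case: (selected_boxP first_dense j) => [|d x Tx [dx _] _].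
      by rewrite half_open_box0 set0I measure0 mule0.
    rewrite -/(cell d x) lebesgue_cell.
    have -> : (cell_side d ^+ n)%:E =
        (2 ^+ n.+1)%:E * (2^-1 ^+ n.+1 * cell_side d ^+ n)%:E :> \bar R.
      by rewrite -EFinM mulrA -exprMn divff// expr1n mul1r.
    by apply: lee_wpmul2l; [rewrite lee_fin exprn_ge0|exact: ltW].
  rewrite nneseriesZl//.
  have -> : \sum_(j <oo) mu (half_open_box (P j) `&` G) =
      mu (\bigcup_j (half_open_box (P j) `&` G)).
    rewrite measure_semi_bigcup//.
    - by move=> j; exact: measurableI.
    - exact: trivIset_setIr.
    - by apply: bigcup_measurable => j _; exact: measurableI.
  apply: (@le_trans _ _ ((2 ^+ n.+1)%:E * mu (T `&` G))).
    apply: lee_wpmul2l; first by rewrite lee_fin exprn_ge0.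
    apply: le_measure; rewrite ?inE.
    + by apply: bigcup_measurable => j _; exact: measurableI.
    + by apply: measurableI => //; exact: measurable_half_open_cube.
    + by move=> x [j _ [/subT ? ?]].
  apply: (@le_trans _ _ ((2 ^+ n.+1)%:E * (2^-1 ^+ n.+2 * r ^+ n)%:E)).
    by apply: lee_wpmul2l => //; rewrite lee_fin exprn_ge0.
  rewrite -EFinM lee_fin mulrA [(2^-1 ^+ n.+2)%R]exprS mulrCA -exprMn divff//.
  by rewrite expr1n mulr1.
- move=> j; rewrite /P; case: (selected_boxP first_dense j) => [|d x Tx [dx fx] _ _].
    by rewrite ltxx.
  (* A selected cell has a parent: level 0 is T itself, which is not dense. *)
  case: d dx fx => [|d] dx fx.
    move: dx; rewrite /dense (cell0E Tx) ltNge => /negP[].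
    apply: (le_trans small); rewrite lee_fin /cell_side expr0 divr1 ler_wpM2r//.
      by rewrite exprn_ge0// ltW.
    rewrite exprS ger_pMl ?exprn_gt0// ?invr_gt0//.
    by rewrite invf_le1// ler1n.
  have {fx} := fx d (ltnSn d); rewrite /dense => /negP; rewrite -leNgt => par.
  rewrite -/(cell d.+1 x).
  have mC := measurable_cell d.+1 x.
  have : mu (cell d.+1 x `&` G) <= (2^-1 * cell_side d.+1 ^+ n)%:E.
    apply: (@le_trans _ _ (mu (cell d x `&` G))).
      apply: le_measure; rewrite ?inE; try exact: measurableI.
        by apply: measurableI => //; exact: measurable_cell.
      by move=> y [/(cell_le (leqnSn d)) ? ?].
    apply: (le_trans par); rewrite (cell_sideS d) exprMn lee_fin exprS mulrA.
    by rewrite -(mulrA 2^-1%R) -exprMn mulVf// expr1n mulr1.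
  move=> le; rewrite measureD//; last by rewrite [X in X < _]lebesgue_cell ltry.
  rewrite sube_gt0; apply: (le_lt_trans le).
  rewrite [X in _ < X]lebesgue_cell lte_fin gtr_pMl ?exprn_gt0 ?cell_side_gt0//.
  by rewrite invf_lt1// ltr1n.
Qed.

End stopping.

(** Otherwise summing over the partition of T into cells of level d would give
    at most half of the integral over T. *)
Lemma heavy_cell (v : vec R n -> \bar R) d : measurable_fun setT v ->
  (forall x, 0 <= v x) -> 0 < \int[mu]_(x in T) v x < +oo ->
  exists2 x, T x & (2^-1 * 2^-1 ^+ (n * d))%:E * \int[mu]_(x in T) v x <=
                   \int[mu]_(x in cell d x) v x.
Proof.
move=> mv v0 /andP[I0 Ioo]; set I := (X in 0 < X) in I0 Ioo *.
have Ifin : I \is a fin_num by rewrite ge0_fin_numE// ltW.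
apply: contrapT => /forall2NP light.
pose sel (d' : nat) (x : vec R n) := d' = d.
pose P := selected_box sel.
have mB := @measurable_half_open_box R n.
have triv : trivIset setT (half_open_box \o P).
  by apply: selected_box_disjoint => // d1 d2 x -> ->.
have TE : T = \bigcup_j half_open_box (P j).
  apply/seteqP; split=> x; last by move=> [j _]; exact: selected_box_sub.
  by move=> Tx; have [j jx] := @selected_box_cover sel d x Tx erefl; exists j.
have : I <= \sum_(j <oo) ((2^-1 * (fine I / r ^+ n))%:E * mu (half_open_box (P j))).
  rewrite /I {1}TE ge0_integral_bigcup//; last exact: measurable_funS mv.
  apply: lee_nneseries => [j _ _|j _]; first exact: integral_ge0.
  rewrite /P; case: (selected_boxP sel j) => [|d' x Tx -> _].
    by rewrite half_open_box0 integral_set0 measure0 mule0.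
  have [//|/negP] := light x; rewrite -ltNge -/(cell d x) => /ltW /le_trans; apply.
  rewrite lebesgue_cell -/I -(fineK Ifin) -!EFinM lee_fin /cell_side.
  rewrite expr_div_n -exprM exprVn mulnC.
  by rewrite le_eqVlt; apply/orP; left; apply/eqP; field; rewrite ?expf_neq0// gt_eqF.
rewrite nneseriesZl//.
have -> : \sum_(j <oo) mu (half_open_box (P j)) = (r ^+ n)%:E.
  rewrite -measure_semi_bigcup//; last exact: bigcup_measurable.
  by rewrite -TE; exact: lebesgue_half_open_cube.
rewrite -(fineK Ifin) -EFinM lee_fin leNgt => /negP; apply.
have fI : (0 < fine I)%R by rewrite fine_gt0// I0.
by rewrite -mulrA divfK ?gtr_pMl ?invf_lt1 ?ltr1n// expf_neq0// gt_eqF.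
Qed.


End dyadic_cells.

(** * Averages and localization of the maximal function *)
Section averages.
Context {R : realType} {n : nat}.
Local Notation mu := (lebesgue_vec R n).
Local Notation box := (vec R n * R)%type.
Implicit Types (p q S T : box) (x y : vec R n) (g : vec R n -> \bar R) (f : vec R n -> R).

Definition average g p : \bar R :=
  (\int[mu]_(y in box_set p) g y) / mu (box_set p).

Definition triple_box p : box := (triple_corner p.1 p.2, 3 * p.2)%R.

Lemma averageE g p : (0 < p.2)%R ->
  average g p = (\int[mu]_(y in box_set p) g y) * ((p.2 ^+ n)^-1)%:E.
Proof.
move=> p0; rewrite /average lebesgue_box_set; last exact: ltW.
by rewrite inver gt_eqF// exprn_gt0.
Qed.

Lemma average_ge0 g p : (forall x, 0 <= g x) -> 0 <= average g p.
Proof.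
move=> g0; apply: mule_ge0; first exact: integral_ge0.
by rewrite inve_ge0.
Qed.

Lemma integral_averageE g p : (0 < p.2)%R ->
  \int[mu]_(y in box_set p) g y = average g p * (p.2 ^+ n)%:E.
Proof.
move=> p0; rewrite averageE// -muleA -EFinM mulVf ?mule1//.
by rewrite gt_eqF// exprn_gt0.
Qed.

Lemma average_cst (c : R) p : (0 < p.2)%R -> average (cst c%:E) p = c%:E.
Proof.
move=> p0; rewrite averageE//.
transitivity (c%:E * mu (box_set p) * ((p.2 ^+ n)^-1)%:E).
  by congr (_ * _); apply: integral_cst; exact: measurable_box_set.
rewrite lebesgue_box_set; last exact: ltW.
by rewrite -muleA -EFinM divff ?mulr1 ?gt_eqF ?exprn_gt0.
Qed.

Lemma le_average g h p : (0 < p.2)%R -> (forall x, box_set p x -> 0 <= g x) ->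
  (forall x, box_set p x -> g x <= h x) -> average g p <= average h p.
Proof.
move=> p0 g0 gh; apply: lee_wpmul2r; first by rewrite inve_ge0.
apply: ae_ge0_le_integral_all; first exact: g0.
  by move=> x px; exact: le_trans (g0 x px) (gh x px).
by apply: aeW => x; exact: gh.
Qed.

Lemma averageD g h p : (0 < p.2)%R -> measurable_fun setT g -> measurable_fun setT h ->
  (forall x, 0 <= g x) -> (forall x, 0 <= h x) ->
  average (fun x => g x + h x) p = average g p + average h p.
Proof.
move=> p0 mg mh g0 h0; rewrite !averageE// ge0_integralD//.
- by rewrite ge0_muleDl//; exact: integral_ge0.
- exact: measurable_box_set.
- exact: measurable_funS mg.
- exact: measurable_funS mh.
Qed.

Lemma average_triple g p : (0 < p.2)%R -> measurable_fun setT g -> (forall x, 0 <= g x) ->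
  average g p <= (3 ^+ n)%:E * average g (triple_box p).
Proof.
move=> p0 mg g0; rewrite !averageE//; last by rewrite mulr_gt0.
rewrite muleCA -EFinM /= exprMn invfM mulrA divff ?expf_neq0// mul1r.
apply: lee_wpmul2r; first by rewrite lee_fin invr_ge0 exprn_ge0// ltW.
apply: ge0_subset_integral => //; try exact: measurable_box_set.
  exact: measurable_funS mg.
exact: (cube_sub_triple_self (ltW p0)).
Qed.

Lemma average_restrict g p (A : set (vec R n)) : box_set p `<=` A ->
  average (g \_ A) p = average g p.
Proof.
move=> pA; congr (_ * _); apply: eq_integral => x /set_mem /pA xA.
by rewrite patchE mem_set.
Qed.

Lemma emaximal_leP g x (c : \bar R) :
  (forall p, (0 < p.2)%R -> box_set p x -> average g p <= c) <-> emaximal g x <= c.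
Proof.
split=> [H|H p p0 px]; last exact: le_trans (average_le_emaximal _ p0 px) H.
by apply: ge_ereal_sup => _ [_ [[a [r [r0 ->]]] ax] <-]; exact: (H (a, r)).
Qed.

(** Large cubes through x are compared with their triple, which contains y; small
    ones lie in the triple of T. *)
Lemma emaximal_localize g T x y : (0 < T.2)%R -> measurable_fun setT g ->
  (forall x, 0 <= g x) -> box_set T x -> box_set T y ->
  emaximal g x <=
    maxe ((3 ^+ n)%:E * emaximal g y) (emaximal (g \_ (box_set (triple_box T))) x).
Proof.
move=> T0 mg g0 Tx Ty; apply/emaximal_leP => S S0 Sx; rewrite le_max.
have [TS|ST] := leP T.2 S.2; apply/orP; [left|right].
  apply: (le_trans (average_triple S0 mg g0)).
  apply: lee_wpmul2l; first by rewrite lee_fin exprn_ge0.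
  apply: average_le_emaximal; first by rewrite mulr_gt0.
  exact: (cube_sub_triple Sx Tx TS) Ty.
rewrite -(@average_restrict g S (box_set (triple_box T))).
  exact: average_le_emaximal.
exact: (cube_sub_triple Tx Sx (ltW ST)).
Qed.

End averages.

Section essential_infimum_on_a_set.
Context {R : realType} {n : nat}.
Local Notation mu := (lebesgue_vec R n).
Implicit Types (A : set (vec R n)) (g : vec R n -> \bar R).

(** The supremum defining the essential infimum is the limit of a sequence, hence
    costs countably many null sets. *)
Lemma ess_inf_on_ae A g : {ae mu, forall x, A x -> ess_inf_on A g <= g x}.
Proof.
rewrite /ess_inf_on; set I := (X in ereal_sup X).
have [->|IN0] := eqVneq I set0.
  by rewrite ereal_sup0; apply: aeW => x _; rewrite leNye.
have [u uI uinf] := ereal_sup_seq IN0.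
have : {ae mu, forall x, forall k, A x -> u k <= g x} by apply/ae_foralln => k; exact: uI.
apply: filterS => x ux Ax; rewrite -(cvg_lim _ uinf)//.
by apply: lime_le; [apply/cvgP: uinf|apply: nearW => k; exact: ux].
Qed.

Lemma le_ess_inf_on A g (y : \bar R) :
  {ae mu, forall x, A x -> y <= g x} -> y <= ess_inf_on A g.
Proof. by move=> H; exact: ereal_sup_ubound. Qed.

Lemma ae_exists A (P : vec R n -> Prop) : measurable A -> 0 < mu A ->
  {ae mu, forall x, A x -> P x} -> exists2 x, A x & P x.
Proof.
move=> mA A0 [N [mN N0 PN]]; apply: contrapT => /forall2NP nAP.
have : mu A <= mu N.
  apply: le_measure; rewrite ?inE// => x Ax; apply: PN => /= /(_ Ax) Px.
  by have [] := nAP x.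
by rewrite N0 leNgt A0.
Qed.

Lemma ess_inf_on_cube (a : vec R n) (r : R) g : (0 < r)%R ->
  ess_inf_on (cube a r) g = ess_inf_on (half_open_cube a r) g.
Proof.
move=> r0; congr ereal_sup; apply/seteqP; split=> y /= H.
  by apply: filterS H => x H /half_open_cube_sub.
by apply: filterS2 H (ae_half_open_cube a r0) => x H I /I.
Qed.

End essential_infimum_on_a_set.

(** * Mean oscillation and the maximal function *)
Section oscillation.
Context {R : realType} {n : nat}.
Local Notation mu := (lebesgue_vec R n).
Local Notation box := (vec R n * R)%type.
Implicit Types (p q S T : box) (x y : vec R n).
Variables (f : vec R n -> R) (mf : measurable_fun setT f).
Hypothesis lf : forall p, (0 < p.2)%R -> \int[mu]_(x in box_set p) `|f x|%:E < +oo.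

Local Notation "|f|" := (fun x => `|f x|%:E).
Local Notation mean_on q := (mean f (box_set q)).
Local Notation deviation q := (fun x => `|f x - mean_on q|%:E).

Lemma measurable_abs_fun : measurable_fun setT |f|.
Proof. by apply/measurable_EFinP; exact: measurableT_comp. Qed.

Lemma measurable_deviation (c : R) : measurable_fun setT (fun x => `|f x - c|%:E).
Proof.
by apply/measurable_EFinP; apply: measurableT_comp => //; exact: measurable_funB.
Qed.

Lemma abs_mean_le_average q : (0 < q.2)%R -> `|mean_on q|%:E <= average |f| q.
Proof.
move=> q0; have qn0 : (0 < q.2 ^+ n)%R by rewrite exprn_gt0.
have intf : mu.-integrable (box_set q) (EFin \o f).
  apply/integrableP; split; last exact: lf.
  by apply/measurable_EFinP; exact: measurable_funS mf.
rewrite averageE// /mean lebesgue_box_set; last exact: ltW.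
rewrite /= normrM normfV (gtr0_norm qn0) EFinM.
apply: lee_wpmul2r; first by rewrite lee_fin invr_ge0 ltW.
rewrite EFin_normr_Rintegral//; last exact: measurable_box_set.
by apply: le_abse_integral; [exact: measurable_box_set|exact: measurable_int intf].
Qed.

Lemma oscillation_le_sharp q x : (0 < q.2)%R -> box_set q x ->
  average (deviation q) q <= sharp_maximal f x.
Proof.
move=> q0 qx; apply: ereal_sup_ubound; exists (box_set q) => //; split=> //.
by exists q.1, q.2.
Qed.

Lemma sharp_maximal_ge0 x : 0 <= sharp_maximal f x.
Proof.
have px : box_set (x, 1%R) x by move=> i /=; rewrite lexx lerDl ler01.
by apply: le_trans (oscillation_le_sharp _ px) => //; exact: average_ge0.
Qed.

(** |f| <= |mean| + |f - mean|, and the mean on q is at most the average of |f|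
    on q.  Keeping the deviation averaged over p, not over q, serves both the
    large and the small cubes of the next lemma. *)
Lemma average_le_oscillation p q : (0 < p.2)%R -> (0 < q.2)%R ->
  average |f| p <= average |f| q + average (deviation q) p.
Proof.
move=> p0 q0; apply: le_trans (leeD2r _ (abs_mean_le_average q0)).
rewrite -(average_cst `|mean_on q| p0) -averageD//; last 2 first.
- exact: measurable_deviation.
- by move=> y; rewrite lee_fin.
apply: le_average => // x _ /=.
by rewrite -EFinD lee_fin -[leLHS](subrK `|mean_on q|%R) addrC lerD2l lerB_dist.
Qed.

(** The bounds m and i are required only for cubes q containing T: for such cubes
    averages of |f| are below every value of M f on T, and oscillations below
    every value of M# f on T. *)
Lemma maximal_localize T x (m i : \bar R) : (0 < T.2)%R -> box_set T x ->
  (forall q, (0 < q.2)%R -> box_set T `<=` box_set q -> average |f| q <= m) ->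
  (forall q, (0 < q.2)%R -> box_set T `<=` box_set q -> average (deviation q) q <= i) ->
  maximal f x <= m + maxe ((3 ^+ n)%:E * i)
    (emaximal (deviation (triple_box T) \_ (box_set (triple_box T))) x).
Proof.
move=> T0 Tx Hm Hi; set q := triple_box T; have q0 : (0 < q.2)%R by rewrite mulr_gt0.
have Tq : box_set T `<=` box_set q by exact/cube_sub_triple_self/ltW.
apply/emaximal_leP => S S0 Sx; have [TS|ST] := leP T.2 S.2.
  pose r := triple_box S; have r0 : (0 < r.2)%R by rewrite mulr_gt0.
  have Tr : box_set T `<=` box_set r by exact: (cube_sub_triple Sx Tx TS).
  apply: (le_trans (average_le_oscillation S0 r0)).
  apply: leeD; first exact: Hm.
  rewrite le_max; apply/orP; left.
  apply: (@le_trans _ _ ((3 ^+ n)%:E * average (deviation r) r)).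
    by apply: average_triple => //; exact: measurable_deviation.
  by apply: lee_wpmul2l; [rewrite lee_fin exprn_ge0|exact: Hi].
have Sq : box_set S `<=` box_set q by exact: (cube_sub_triple Tx Sx (ltW ST)).
apply: (le_trans (average_le_oscillation S0 q0)).
apply: leeD; first exact: Hm.
rewrite le_max; apply/orP; right.
by rewrite -(average_restrict _ Sq); exact: average_le_emaximal.
Qed.

(** The factor 9 ^+ n is the weak type constant 3 ^+ n times the volume ratio of a
    cube and its triple; 2 ^+ n.+2 makes the exceptional set small enough for the
    dyadic stopping. *)
Definition step_constant : R := (9 ^+ n * 2 ^+ n.+2)%R.

Lemma step_constant_ge : (3 ^+ n <= step_constant)%R.
Proof.
rewrite /step_constant -[leLHS]mulr1 ler_pM ?exprn_ge0//.
  by rewrite lerXn2r ?nnegrE// ler_nat.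
by rewrite exprn_ege1// ler1n.
Qed.

Lemma step_constant_gt0 : (0 < step_constant)%R.
Proof. by rewrite mulr_gt0// exprn_gt0. Qed.

Lemma large_maximal_small T (m i : R) : (0 < T.2)%R -> (0 <= i)%R ->
  (forall q, (0 < q.2)%R -> box_set T `<=` box_set q -> average |f| q <= m%:E) ->
  (forall q, (0 < q.2)%R -> box_set T `<=` box_set q -> average (deviation q) q <= i%:E) ->
  mu (box_set T `&` [set x | (m + step_constant * i)%:E < maximal f x]) <=
    (2^-1 ^+ n.+2 * T.2 ^+ n)%:E.
Proof.
move=> T0 i0 Hm Hi.
pose q := triple_box T; have q0 : (0 < q.2)%R by rewrite mulr_gt0.
have Tq : box_set T `<=` box_set q by exact/cube_sub_triple_self/ltW.
pose g := deviation q \_ (box_set q).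
have mg : measurable_fun setT g.
  apply/(measurable_restrictT _ _).1; first exact: measurable_box_set.
  by apply: (@measurable_funS _ _ _ _ setT) => //; exact: measurable_deviation.
have g0 x : 0 <= g x by rewrite /g patchE; case: ifP.
have gi : \int[mu]_x g x <= (3 ^+ n * T.2 ^+ n * i)%:E.
  rewrite -integral_mkcond integral_averageE// muleC.
  rewrite -exprMn EFinM; apply: lee_wpmul2l; last exact: Hi.
  by rewrite lee_fin exprn_ge0// ltW.
set G := [set x | _].
have sub : box_set T `&` G `<=` [set x | (step_constant * i)%:E < emaximal g x].
  move=> x [Tx /= Gx].
  have := lt_le_trans Gx (maximal_localize T0 Tx Hm Hi).
  rewrite EFinD lteD2lE// lt_max => /orP[|//].
  by rewrite -EFinM lte_fin ltNge ler_wpM2r// step_constant_ge.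
have mG : measurable G by apply: measurable_superlevel => //; exact: measurable_abs_fun.
have mTG : measurable (box_set T `&` G) by apply: measurableI => //; exact: measurable_box_set.
have mS := @measurable_superlevel R n g mg g0.
have [i_gt0|] := ltP 0%R i; last first.
  move=> i_le0; have {i_le0} i0' : i = 0%R by apply/eqP; rewrite eq_le i_le0.
  (* Without oscillation f is constant on the triple: the small cubes
   contribute nothing. *)
  suff -> : box_set T `&` G = set0.
    by rewrite measure0 lee_fin mulr_ge0 ?exprn_ge0 ?invr_ge0// ltW.
  apply/seteqP; split=> // x /sub /=; rewrite i0' mulr0 ltNge => /negP; apply.
  apply/emaximal_leP => p p0 px; rewrite averageE//.
  apply: mule_le0_ge0; last by rewrite lee_fin invr_ge0 exprn_ge0// ltW.
  rewrite i0' mulr0 in gi; apply: le_trans gi.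
  by apply: ge0_subset_integral => //; exact: measurable_box_set.
have ci0 : (0 < step_constant * i)%R by rewrite mulr_gt0// step_constant_gt0.
apply: (@le_trans _ _ (mu [set x | (step_constant * i)%:E < emaximal g x])).
  by apply: le_measure sub; rewrite inE; [exact: mTG|exact: mS].
rewrite -(@lee_pmul2l _ (step_constant * i)%:E)//.
apply: (le_trans (weak_type mg g0 (ltW ci0))).
apply: (@le_trans _ _ ((3 ^+ n)%:E * (3 ^+ n * T.2 ^+ n * i)%:E)).
  by apply: lee_wpmul2l => //; rewrite lee_fin exprn_ge0.
rewrite -!EFinM lee_fin /step_constant.
have -> : (9 ^+ n = 3 ^+ n * 3 ^+ n :> R)%R by rewrite -exprMn -natrM.
have e2 : (2 ^+ n.+2 * 2^-1 ^+ n.+2 = 1 :> R)%R by rewrite -exprMn divff// expr1n.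
rewrite [leRHS](_ : _ = 3 ^+ n * 3 ^+ n * i * T.2 ^+ n * (2 ^+ n.+2 * 2^-1 ^+ n.+2))%R.
  by rewrite e2; lra.
ring.
Qed.

End oscillation.

(** * The stopping cubes of a cube *)
Section stopping_family.
Context {R : realType} {n : nat}.
Local Notation mu := (lebesgue_vec R n).
Local Notation box := (vec R n * R)%type.
Implicit Types (p q S T : box) (x y : vec R n).
Hypothesis n_gt0 : (0 < n)%N.
Variables (f : vec R n -> R) (mf : measurable_fun setT f).
Hypothesis lf : forall p, (0 < p.2)%R -> \int[mu]_(x in box_set p) `|f x|%:E < +oo.

Definition floor_maximal T : \bar R := ess_inf_on (half_open_box T) (maximal f).

Hypothesis fin_floor : forall T, (0 < T.2)%R -> floor_maximal T \is a fin_num.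

Local Notation step := (@step_constant R n).

(** The last two clauses bound M f off the cubes, and the floor on the cubes, with
    the same increment; iterating them is what makes M f grow linearly with the
    number of generations. *)
Definition stopping_family T (P : nat -> box) :=
  [/\ trivIset setT (half_open_box \o P),
      forall j, (0 <= (P j).2)%R /\ half_open_box (P j) `<=` half_open_box T,
      \sum_(j <oo) mu (half_open_box (P j)) <= (2^-1 * T.2 ^+ n)%:E,
      forall x, half_open_box T x -> (forall j, ~ half_open_box (P j) x) ->
        maximal f x <= floor_maximal T + step%:E * sharp_maximal f x &
      forall j x, (0 < (P j).2)%R -> half_open_box T x ->
        floor_maximal (P j) <= floor_maximal T + step%:E * sharp_maximal f x].

(** The set to be covered is where M f exceeds the floor of T by more than
    step_constant times inf_T M# f; if this infimum is infinite it is empty. *)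
Lemma exists_stopping_family T : (0 <= T.2)%R -> exists P, stopping_family T P.
Proof.
rewrite le_eqVlt => /predU1P[/esym T0|T0].
  exists (fun=> T); have E := half_open_box_empty n_gt0 T0.
  split => //.
  - by move=> i j _ _ [x []] /=; rewrite E.
  - by move=> j; rewrite T0; split.
  - rewrite E T0 expr0n gtn_eqF// mulr0n mulr0.
    by rewrite eseries0// => j _ _; rewrite measure0.
  - by rewrite E.
  - by move=> j x; rewrite T0 ltxx.
pose i := ereal_inf (sharp_maximal f @` half_open_box T).
have i_le x : half_open_box T x -> i <= sharp_maximal f x.
  by move=> Tx; apply: ereal_inf_lbound; exists x.
have i0 : 0 <= i.
  by apply: le_ereal_inf_tmp => _ [x _ <-]; exact: sharp_maximal_ge0.
have step0 : 0 <= step%:E by rewrite lee_fin ltW// step_constant_gt0.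
have TT := @half_open_cube_sub R n T.1 T.2.
have muT : 0 < mu (half_open_box T).
  by rewrite lebesgue_half_open_cube// lte_fin exprn_gt0.
have Hm q : (0 < q.2)%R -> box_set T `<=` box_set q ->
    average (fun x => `|f x|%:E) q <= floor_maximal T.
  move=> q0 Tq; apply: le_ess_inf_on; apply: aeW => x Tx.
  exact/(average_le_emaximal _ q0)/Tq/TT.
have Hi q : (0 < q.2)%R -> box_set T `<=` box_set q ->
    average (fun x => `|f x - mean f (box_set q)|%:E) q <= i.
  move=> q0 Tq; apply: le_ereal_inf_tmp => _ [x Tx <-].
  exact/oscillation_le_sharp/Tq/TT.
have [G [mG oG small GE]] : exists G : set (vec R n), [/\ measurable G, sup_open G,
    mu (half_open_box T `&` G) <= (2^-1 ^+ n.+2 * T.2 ^+ n)%:E &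
    forall x, ~ G x -> maximal f x <= floor_maximal T + step%:E * i].
  have mfin := fin_floor T0.
  have r0 : (0 <= 2^-1 ^+ n.+2 * T.2 ^+ n)%R.
    by rewrite mulr_ge0// exprn_ge0// ?invr_ge0// ltW.
  move: i0 Hi; case: i {i_le} => [i| |]// i0 Hi; last first.
    exists set0; split => //; first by rewrite setI0 measure0 lee_fin.
    move=> x _; rewrite gt0_muley ?lte_fin ?step_constant_gt0//.
    by case: (floor_maximal T) mfin => // m _; rewrite addey// leey.
  rewrite -(fineK mfin) in Hm *.
  exists [set x | (fine (floor_maximal T) + step * i)%:E < maximal f x]; split.
  - by apply: measurable_superlevel => //; exact: measurable_abs_fun.
  - by apply: open_superlevel => //; exact: measurable_abs_fun.
  - apply: le_trans (large_maximal_small mf lf T0 i0 Hm Hi).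
    apply: le_measure; rewrite ?inE.
    + apply: measurableI; first exact: measurable_half_open_box.
      by apply: measurable_superlevel => //; exact: measurable_abs_fun.
    + apply: measurableI; first exact: measurable_box_set.
      by apply: measurable_superlevel => //; exact: measurable_abs_fun.
    + by apply: setSI; exact: TT.
  - by move=> x /negP; rewrite -leNgt.
have [P [P1 P2 P3 P4 P5]] := dyadic_stopping T0 n_gt0 mG oG small.
exists P; split => //.
- move=> x Tx nPx; have [Gx|/GE] := pselect (G x).
    by have [j _ /nPx] := P3 x (conj Tx Gx).
  move=> /le_trans; apply; apply: leeD2l.
  by apply: lee_wpmul2l => //; exact: i_le.
- move=> j x Pj0 Tx.
  (* P j is not filled by G, so its floor is below a value of M f off G *)
  have [y [Py nGy]] : exists2 y, (half_open_box (P j) `\` G) y &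
      floor_maximal (P j) <= maximal f y.
    apply: ae_exists; [|exact: P5|].
      by apply: measurableD => //; exact: measurable_half_open_box.
    by apply: filterS (ess_inf_on_ae (half_open_box (P j)) (maximal f)) => y Py [/Py].
  move=> /le_trans; apply; apply: (le_trans (GE _ nGy)); apply: leeD2l.
  by apply: lee_wpmul2l => //; exact: i_le.
Qed.

End stopping_family.

(** * Generations of stopping cubes *)
Section generations.
Context {R : realType} {n : nat}.
Local Notation mu := (lebesgue_vec R n).
Local Notation box := (vec R n * R)%type.
Implicit Types (p q S T : box) (x y : vec R n) (k : nat).
Local Notation step := (@step_constant R n).
Hypothesis n_gt0 : (0 < n)%N.
Variables (f : vec R n -> R) (next : box -> nat -> box).
Hypothesis nextP : forall T, (0 <= T.2)%R -> stopping_family f T (next T).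

Fixpoint generation k T : set (vec R n) :=
  if k is k'.+1 then \bigcup_j generation k' (next T j) else half_open_box T.

Lemma next_ge0 T j : (0 <= T.2)%R -> (0 <= (next T j).2)%R.
Proof. by move=> /nextP[_ + _ _ _] => /(_ j) []. Qed.

Lemma next_sub T j : (0 <= T.2)%R -> half_open_box (next T j) `<=` half_open_box T.
Proof. by move=> /nextP[_ + _ _ _] => /(_ j) []. Qed.

Lemma measurable_generation k T : measurable (generation k T).
Proof.
elim: k T => [|k IH] T /=; first exact: measurable_half_open_box.
exact: bigcup_measurable.
Qed.

Lemma generation_sub k T : (0 <= T.2)%R -> generation k T `<=` half_open_box T.
Proof.
elim: k T => [|k IH] T T0 //= x [j _ /(IH _ (next_ge0 j T0))].
exact: next_sub.
Qed.

Lemma generation_disjoint k T : (0 <= T.2)%R ->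
  trivIset setT (fun j => generation k (next T j)).
Proof.
move=> T0; have [tr _ _ _ _] := nextP T0.
move=> i j _ _ [x [ix jx]]; apply: tr => //; exists x; split => /=.
  by apply: (@generation_sub k); [exact: next_ge0|exact: ix].
by apply: (@generation_sub k); [exact: next_ge0|exact: jx].
Qed.

Lemma lebesgue_generation k T : (0 <= T.2)%R ->
  mu (generation k T) <= (2^-1 ^+ k * T.2 ^+ n)%:E.
Proof.
elim: k T => [|k IH] T T0.
  by rewrite expr0 mul1r /= lebesgue_half_open_box.
have [_ _ P3 _ _] := nextP T0.
apply: (@le_trans _ _ (\sum_(j <oo) mu (generation k (next T j)))).
  apply: measure_sigma_subadditive; last exact: subset_refl.
    by move=> j; exact: measurable_generation.
  exact: (measurable_generation k.+1).
apply: (@le_trans _ _ (\sum_(j <oo) ((2^-1 ^+ k)%:E * mu (half_open_box (next T j))))).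
  apply: lee_nneseries => // j _; have j0 := next_ge0 j T0.
  by rewrite lebesgue_half_open_box// -EFinM; exact: IH.
rewrite nneseriesZl// exprSr -mulrA EFinM; apply: lee_wpmul2l => //.
Qed.

(** Each generation has at most half of the measure of the previous one. *)
Lemma null_generations T : (0 <= T.2)%R ->
  mu.-negligible (\bigcap_k generation k T).
Proof.
move=> T0; exists (\bigcap_k generation k T).
have mI : measurable (\bigcap_k generation k T).
  by apply: bigcap_measurable => // k _; exact: measurable_generation.
split=> //; apply/eqP; rewrite eq_le measure_ge0 andbT.
apply/lee_addgt0Pr => e e0; rewrite add0e.
have rn0 : (0 <= T.2 ^+ n)%R by rewrite exprn_ge0.
pose k := Num.bound (T.2 ^+ n / e).
apply: (@le_trans _ _ (mu (generation k T))).
  apply: le_measure; rewrite ?inE//; first exact: measurable_generation.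
  by move=> x; exact.
apply: (le_trans (lebesgue_generation k T0)); rewrite lee_fin exprVn.
rewrite ler_pdivrMl ?exprn_gt0// -ler_pdivrMr//.
exact/ltW/upper_nthrootP.
Qed.

(** Induction on k: a point outside all the children of T is settled by one step;
    in a child P the claim for P and the bound on the floor of P add up. *)
Lemma maximal_outside_generation k T x : (0 <= T.2)%R -> half_open_box T x ->
  ~ generation k T x ->
  maximal f x <= floor_maximal f T +
                 (k%:R * step)%:E * sharp_maximal f x.
Proof.
have c0 : (0 <= step)%R by exact/ltW/step_constant_gt0.
have s0 := sharp_maximal_ge0 f x.
elim: k T => [|k IH] T T0 Tx //= nx.
have [_ _ _ P4 P5] := nextP T0.
have E : (k.+1%:R * step)%:E * sharp_maximal f x =
    (step)%:E * sharp_maximal f x +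
    (k%:R * step)%:E * sharp_maximal f x.
  rewrite -ge0_muleDl ?lee_fin//; last by rewrite mulr_ge0.
  by rewrite -EFinD -natr1 mulrDl mul1r addrC.
rewrite E; have [[j jx]|nj] := pselect (exists j, half_open_box (next T j) x).
  have j0 := next_ge0 j T0.
  have jpos : (0 < (next T j).2)%R.
    rewrite lt_neqAle j0 andbT eq_sym; apply/eqP => j0'.
    by move: jx; rewrite (half_open_box_empty n_gt0 j0').
  apply: (le_trans (IH _ j0 jx _)); first by move=> jkx; apply: nx; exists j.
  by rewrite addeA; apply: leeD2r; exact: P5.
apply: (le_trans (P4 _ Tx _)); first by move=> j jx; apply: nj; exists j.
by apply: leeD2l; rewrite leeDl// mule_ge0// lee_fin mulr_ge0.
Qed.

Section carleson.
Variables (w v : vec R n -> \bar R).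
Hypotheses (mw : measurable_fun setT w) (w0 : forall x, 0 <= w x).
Hypotheses (mv : measurable_fun setT v) (v0 : forall x, 0 <= v x).
Local Notation W A := (\int[mu]_(x in A) w x).

Lemma integral_generationS (u : vec R n -> \bar R) k T : (0 <= T.2)%R ->
  measurable_fun setT u -> (forall x, 0 <= u x) ->
  \int[mu]_(x in generation k.+1 T) u x =
  \sum_(j <oo) \int[mu]_(x in generation k (next T j)) u x.
Proof.
move=> T0 mu' u0; rewrite ge0_integral_bigcup//.
- by move=> j; exact: measurable_generation.
- exact: measurable_funS mu'.
- exact: generation_disjoint.
Qed.

(** The average of w on T is a lower bound for v on T, and half of T lies outside
    the children of T: so w(T) is at most twice the integral of v over that half.
    These halves are disjoint for different cubes. *)
Lemma carleson (Q : set (vec R n)) T K :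
  (forall p x, (0 < p.2)%R -> half_open_box p `<=` Q -> half_open_box p x ->
    W (half_open_box p) * ((p.2 ^+ n)^-1)%:E <= v x) ->
  (0 <= T.2)%R -> half_open_box T `<=` Q ->
  \sum_(0 <= k < K) W (generation k T) <= 2%:E * \int[mu]_(x in half_open_box T) v x.
Proof.
move=> Hv; elim: K T => [|K IH] T T0 TQ.
  by rewrite big_geq// mule_ge0 ?integral_ge0.
have W0 A : 0 <= W A by exact: integral_ge0.
have mT := measurable_half_open_box T.
have mU : measurable (generation 1 T) by exact: measurable_generation.
have UT : generation 1 T `<=` half_open_box T by exact: generation_sub.
rewrite big_nat_recl//=.
rewrite (_ : \sum_(0 <= k < K) _ =
    \sum_(j <oo) \sum_(0 <= k < K) W (generation k (next T j))); last first.
  rewrite nneseries_sum_nat//.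
  by apply: eq_bigr => k _; exact: (integral_generationS k T0).
have splitv : \int[mu]_(x in half_open_box T) v x =
    \int[mu]_(x in half_open_box T `\` generation 1 T) v x +
    \int[mu]_(x in generation 1 T) v x.
  rewrite -ge0_integral_setU//.
  - by rewrite setUC setDUK.
  - exact: measurableD.
  - exact: measurable_funS mv.
  - by rewrite disj_set2E setDKI.
rewrite splitv ge0_muleDr ?integral_ge0//; apply: leeD; last first.
  rewrite (integral_generationS 0 T0 mv v0) -nneseriesZl; last first.
    by move=> j _; exact: integral_ge0.
  apply: lee_nneseries => [j _ _|j _]; first exact: sume_ge0.
  apply: IH; first exact: next_ge0.
  by move=> x /(next_sub T0) /TQ.
have [T0'|Tpos] := leP T.2 0%R.
  have {T0'}T0' : T.2 = 0%R by apply/eqP; rewrite eq_le T0' T0.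
  rewrite [X in \int[mu]_(x in X) w x](half_open_box_empty n_gt0 T0') integral_set0.
  by rewrite mule_ge0 ?integral_ge0.
pose avg := W (half_open_box T) * ((T.2 ^+ n)^-1)%:E.
have rn0 : (0 < T.2 ^+ n)%R by rewrite exprn_gt0.
have avg0 : 0 <= avg by rewrite mule_ge0// lee_fin invr_ge0 ltW.
have half : (2^-1 * T.2 ^+ n)%:E <= mu (half_open_box T `\` generation 1 T).
  rewrite measureD//; last by rewrite [X in X < _]lebesgue_half_open_box ?ltry.
  rewrite setIidr// -[X in X <= _](_ : (T.2 ^+ n)%:E - (2^-1 * T.2 ^+ n)%:E = _).
    apply: leeB; first by rewrite [X in _ <= X]lebesgue_half_open_box.
    by apply: le_trans (lebesgue_generation 1 T0) _; rewrite expr1.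
  by rewrite -EFinB; congr EFin; lra.
apply: (@le_trans _ _ (2%:E * (avg * mu (half_open_box T `\` generation 1 T)))); last first.
  apply: lee_wpmul2l => //.
  rewrite -[X in X <= _](integral_cst mu (measurableD mT mU)).
  apply: ge0_le_integral => //; first exact: measurableD.
    exact: measurable_funS mv.
  by move=> x [Tx _]; exact: Hv.
apply: (@le_trans _ _ (2%:E * (avg * (2^-1 * T.2 ^+ n)%:E))); last first.
  by apply: lee_wpmul2l => //; exact: lee_wpmul2l.
rewrite /avg -muleA -EFinM muleCA -EFinM.
rewrite (_ : _ * _ = 1)%R ?mule1//.
by field; rewrite gt_eqF.
Qed.

End carleson.
End generations.

(** * Sequences dominating their tails *)
Section geometric_tails.
Context {R : realType}.
Variables (a : nat -> R) (L : R).
Hypotheses (a0 : forall k, (0 <= a k)%R) (L0 : (0 < L)%R).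
Hypothesis tail : forall j K, (\sum_(0 <= k < K) a (j + k)%N <= L * a j)%R.
Let r : R := (1 + (2 * L)^-1)%R.

(** Let S_j be the tail sum and F_j the weighted one.  Then
    F_j = a_j + r F_{j+1} <= a_j + 2 r S_{j+1} by induction, and this is at most
    2 S_j because 2 (r - 1) S_{j+1} = S_{j+1} / L <= a_j. *)
Lemma geometric_tail_sum K j :
  (\sum_(0 <= k < K) r ^+ k * a (j + k)%N <= 2 * \sum_(0 <= k < K) a (j + k)%N)%R.
Proof.
have r0 : (0 <= r)%R by rewrite addr_ge0// invr_ge0 mulr_ge0// ltW.
elim: K j => [|K IH] j; first by rewrite !big_geq// mulr0.
rewrite big_nat_recl// [in leRHS]big_nat_recl// expr0 mul1r addn0.
under eq_bigr do rewrite exprS -mulrA addnS -addSn.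
rewrite -mulr_sumr.
under [in leRHS]eq_bigr do rewrite addnS -addSn.
set S := (\sum_(0 <= k < K) a (j.+1 + k)%N)%R.
have S0 : (0 <= S)%R by apply: sumr_ge0.
have SL : (S <= L * a j)%R.
  apply: le_trans (tail j K.+1); rewrite big_nat_recl// addn0.
  under [in leRHS]eq_bigr do rewrite addnS -addSn.
  by rewrite lerDr.
apply: (@le_trans _ _ (a j + r * (2 * S))%R).
  by rewrite lerD2l ler_wpM2l//; exact: IH.
rewrite /r mulrDl mul1r invfM mulrACA mulVf// mul1r mulrDr.
suff : (L^-1 * S <= a j)%R by move=> H; lra.
by rewrite mulrC ler_pdivrMr// mulrC.
Qed.

(** The sum is a_0 + (r - 1) F_0 with r - 1 = L^-1 / 2, and
    F_0 <= 2 S_0 <= 2 L a_0. *)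
Lemma geometric_sum K :
  (r * a 0%N + \sum_(0 <= k < K) (L^-1 / 2 * r ^+ k.+1) * a k.+1 <= 2 * a 0%N)%R.
Proof.
have r0 : (0 <= r)%R by rewrite addr_ge0// invr_ge0 mulr_ge0// ltW.
have := geometric_tail_sum K.+1 0; rewrite big_nat_recl// expr0 mul1r add0n.
have -> : (\sum_(0 <= i < K) r ^+ i.+1 * a (0 + i.+1)%N = \sum_(0 <= i < K) r ^+ i.+1 * a i.+1)%R.
  by apply: eq_bigr.
have := tail 0 K.+1.
set S := (\sum_(0 <= k < K.+1) _)%R; set F := (\sum_(0 <= i < K) _)%R => SL FS.
rewrite (_ : \sum_(0 <= k < K) _ = L^-1 / 2 * F)%R; last first.
  by rewrite /F mulr_sumr; apply: eq_bigr => k _; rewrite mulrA.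
have : (L^-1 / 2 * (a 0%N + F) <= L^-1 / 2 * (2 * (L * a 0%N)))%R.
  rewrite ler_wpM2l ?divr_ge0 ?invr_ge0 ?(ltW L0)//.
  by apply: (le_trans FS); rewrite ler_wpM2l.
rewrite [leRHS](_ : _ = a 0%N)%R; last by field; rewrite gt_eqF.
rewrite /r invfM [(2^-1 * _)%R]mulrC => H.
by rewrite mulrDl mul1r -addrA; rewrite mulrDr in H; lra.
Qed.

End geometric_tails.

Section exponential_bound.
Context {R : realType}.

(** With s = 1 / (2L + 1) one has expR s <= 1 + 1/(2L), and s k / p is at most its
    exponential; then 1 / s <= 3 L. *)
Lemma powR_le_geometric (L p : R) (k : nat) : (1 <= L)%R -> (1 <= p)%R ->
  (k%:R `^ p <= (3 * L * p) `^ p * (1 + (2 * L)^-1) ^+ k)%R.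
Proof.
move=> L1 p1; have L0 : (0 < L)%R by lra.
have p0 : (0 < p)%R by lra.
pose s := (2 * L + 1)^-1%R.
have s0 : (0 < s)%R by rewrite invr_gt0; lra.
have es : (expR s <= 1 + (2 * L)^-1)%R.
  rewrite -[s]opprK expRN invf_ple ?posrE ?expR_gt0//; last first.
    by rewrite addr_gt0// invr_gt0 mulr_gt0.
  apply: le_trans (expR_ge1Dx _).
  rewrite le_eqVlt; apply/orP; left; apply/eqP; rewrite /s; field.
  by rewrite !gt_eqF//; lra.
have kexp : (k%:R <= p / s * expR (s * k%:R / p))%R.
  rewrite mulrC -ler_pdivrMr ?divr_gt0//.
  apply: le_trans (expR_ge1Dx _).
  rewrite invf_div mulrA [(k%:R * s)%R]mulrC.
  by rewrite lerDr.
apply: (@le_trans _ _ ((p / s * expR (s * k%:R / p)) `^ p)%R).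
  apply: ge0_ler_powR => //; [exact: ltW|exact: ler0n|].
  by rewrite nnegrE mulr_ge0 ?expR_ge0// divr_ge0// ltW.
rewrite powRM ?expR_ge0//; last by rewrite divr_ge0// ltW.
have eE : (expR (s * k%:R / p) `^ p = expR s ^+ k)%R.
  by rewrite -expRM_natr -expRM; congr expR; field; rewrite gt_eqF.
rewrite eE; apply: ler_pM; rewrite ?powR_ge0 ?exprn_ge0 ?expR_ge0//.
  apply: ge0_ler_powR; [exact: ltW|by rewrite nnegrE divr_ge0// ltW| |].
    by rewrite nnegrE !mulr_ge0//; lra.
  by rewrite /s invrK mulrC ler_wpM2r//; lra.
by rewrite lerXn2r ?nnegrE ?expR_ge0// addr_ge0// invr_ge0 mulr_ge0// ltW.
Qed.

End exponential_bound.

(** * Finiteness of the maximal function *)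
Section finiteness.
Context {R : realType} {n : nat}.
Local Notation mu := (lebesgue_vec R n).
Local Notation box := (vec R n * R)%type.
Implicit Types (p q S T : box) (x y : vec R n) (k : nat).

Lemma emaximal_finite_ae (g : vec R n -> \bar R) : measurable_fun setT g ->
  (forall x, 0 <= g x) -> \int[mu]_x g x < +oo ->
  {ae mu, forall x, emaximal g x < +oo}.
Proof.
move=> mg g0 gfin.
have Ifin : \int[mu]_x g x \is a fin_num by rewrite ge0_fin_numE// integral_ge0.
pose c := (3 ^+ n * fine (\int[mu]_x g x))%R.
have c0 : (0 <= c)%R by rewrite mulr_ge0 ?exprn_ge0// fine_ge0// integral_ge0.
pose A := \bigcap_k [set x | k%:R%:E < emaximal g x].
have mA : measurable A.
  by apply: bigcap_measurable => // k _; exact: measurable_superlevel.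
exists A; split => //; last first.
  move=> x /= /negP; rewrite -leNgt leye_eq => /eqP Mx k _ /=.
  by rewrite Mx ltry.
apply/eqP; rewrite eq_le measure_ge0 andbT.
apply/lee_addgt0Pr => e e0; rewrite add0e.
pose k := (Num.bound (c / e)).+1.
have k0 : (0 < k%:R :> R)%R by rewrite ltr0n.
rewrite -(@lee_pmul2l _ k%:R%:E)//.
apply: (@le_trans _ _ (k%:R%:E * mu [set x | k%:R%:E < emaximal g x])).
  apply: lee_wpmul2l; first by rewrite lee_fin.
  by apply: le_measure; rewrite ?inE//; [exact: measurable_superlevel|move=> x; exact].
apply: (le_trans (weak_type mg g0 (ltW k0))).
rewrite -(fineK Ifin) -EFinM -/c lee_fin -ler_pdivrMr//.
have := archi_boundP (divr_ge0 c0 (ltW e0)); rewrite -/k => /ltW /le_trans; apply.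
by rewrite ler_nat.
Qed.

Lemma enclosing_box T x : (0 < T.2)%R -> exists q : box,
  [/\ (0 < q.2)%R, box_set T `<=` box_set q & box_set q x].
Proof.
move=> T0; pose s := (\sum_(i < n) `|tnth x i - tnth T.1 i|)%R.
pose c : vec R n := mktuple (fun i => Num.min (tnth T.1 i) (tnth x i)).
have si i : (`|tnth x i - tnth T.1 i| <= s)%R.
  by rewrite /s (bigD1 i)//= lerDl sumr_ge0.
have s0 : (0 <= s)%R by rewrite sumr_ge0.
have cE i : tnth c i = Num.min (tnth T.1 i) (tnth x i) by rewrite tnth_mktuple.
exists (c, T.2 + s)%R; split => /=; first by rewrite ltr_wpDr.
  move=> y Ty i; have /andP[/= ? ?] := Ty i; rewrite /= cE.
  have := si i; rewrite ler_norml => /andP[? ?].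
  by apply/andP; split; rewrite minElt; case: ltP => ?; lra.
move=> i; rewrite /= cE; have := si i; rewrite ler_norml => /andP[? ?].
by apply/andP; split; rewrite minElt; case: ltP => ?; lra.
Qed.

Variables (f : vec R n -> R) (mf : measurable_fun setT f).
Hypothesis lf : forall p, (0 < p.2)%R -> \int[mu]_(x in box_set p) `|f x|%:E < +oo.
Hypothesis Mf : exists x, maximal f x < +oo.

(** A single point x0 where M f is finite controls the large cubes; the small ones
    see an integrable function, for which the weak type inequality applies. *)
Lemma maximal_finite_ae T : (0 < T.2)%R ->
  {ae mu, forall x, box_set T x -> maximal f x < +oo}.
Proof.
move=> T0; have [x0 Mx0] := Mf; have [q [q0 Tq qx0]] := enclosing_box x0 T0.
have r0 : (0 < (triple_box q).2)%R by rewrite mulr_gt0.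
have ma := measurable_abs_fun mf.
pose g := (fun x => `|f x|%:E) \_ (box_set (triple_box q)).
have mg : measurable_fun setT g.
  apply/(measurable_restrictT _ _).1; first exact: measurable_box_set.
  exact: (@measurable_funS _ _ _ _ setT).
have g0 x : 0 <= g x by rewrite /g patchE; case: ifP.
have gfin : \int[mu]_x g x < +oo by rewrite -integral_mkcond; exact: lf.
apply: filterS (emaximal_finite_ae mg g0 gfin) => x gx Tx.
have := emaximal_localize q0 ma (fun=> normr_ge0 _) (Tq _ Tx) qx0.
move=> /le_lt_trans; apply; rewrite gt_max gx andbT.
have Mx0fin : emaximal (fun x => `|f x|%:E) x0 \is a fin_num.
  by rewrite ge0_fin_numE// emaximal_ge0.
by rewrite -(fineK Mx0fin) -EFinM ltry.
Qed.

Lemma floor_maximal_fin_num T : (0 < T.2)%R -> floor_maximal f T \is a fin_num.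
Proof.
move=> T0; rewrite ge0_fin_numE; last first.
  by apply: le_ess_inf_on; apply: aeW => x _; exact: emaximal_ge0.
have muT : 0 < mu (half_open_box T).
  by rewrite lebesgue_half_open_cube// lte_fin exprn_gt0.
have [|x Tx [/le_lt_trans]] := @ae_exists R n (half_open_box T)
    (fun x => floor_maximal f T <= maximal f x /\ maximal f x < +oo)
    (measurable_half_open_box T) muT; last by apply.
apply: filterS2 (ess_inf_on_ae (half_open_box T) (maximal f)) (maximal_finite_ae T0).
by move=> x H1 H2 Tx; split; [exact: H1|exact/H2/half_open_cube_sub].
Qed.

End finiteness.

Section ratio.
Context {R : realType}.
Implicit Types (M m s : \bar R) (c : R).

(** This holds for all values of s: the quotient is 0 when s is infinite, and when
    s = 0 the numerator vanishes. *)
Lemma ratio_bound M m s c : m \is a fin_num -> (0 <= c)%R -> 0 <= s -> m <= M ->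
  M <= m + c%:E * s -> 0 <= (M - m) / s <= c%:E.
Proof.
case: m => // m _ c0 s0 mM Ms.
have num0 : 0 <= M - m%:E by rewrite sube_ge0.
apply/andP; split; first by rewrite mule_ge0// inve_ge0.
case: s s0 Ms => [s| |]// s0 Ms; last by rewrite invey mule0 lee_fin.
move: s0; rewrite lee_fin le_eqVlt => /predU1P[s0|s0].
  rewrite (_ : M - m%:E = 0) ?mul0e ?lee_fin//.
  apply/eqP; rewrite eq_le num0 andbT.
  by rewrite sube_le0; move: Ms; rewrite -s0 mule0 adde0.
rewrite inver gt_eqF// lee_pdivrMr// -EFinM.
by rewrite leeBlDl// EFinM.
Qed.

End ratio.

(** * Weights of generations *)
Section borel_weight.
Context {R : realType} {n : nat}.
Local Notation mu := (lebesgue_vec R n).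
Local Notation box := (vec R n * R)%type.
Implicit Types (p q S T : box) (x y : vec R n) (k : nat).
Hypothesis n_gt0 : (0 < n)%N.
Variables (w : vec R n -> R) (mw : measurable_fun setT w).
Hypothesis w_gt0 : forall x, (0 < w x)%R.
Hypothesis lw : forall p, (0 < p.2)%R -> \int[mu]_(x in box_set p) (w x)%:E < +oo.

Lemma measurable_weight : measurable_fun setT (fun x => (w x)%:E).
Proof. exact/measurable_EFinP. Qed.

Lemma weight_ge0 x : 0 <= (w x)%:E.
Proof. by rewrite lee_fin ltW. Qed.

Lemma weight_of_half_open_box p : (0 < p.2)%R ->
  weight_of w (box_set p) = weight_of w (half_open_box p).
Proof.
by move=> p0; apply: ge0_integral_half_open_cube => //;
  [exact: measurable_weight|exact: weight_ge0].
Qed.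

Lemma weight_of_gt0 p : (0 < p.2)%R -> 0 < weight_of w (box_set p).
Proof.
move=> p0; rewrite lt_neqAle integral_ge0 ?andbT; last by move=> x _; exact: weight_ge0.
apply/eqP => /esym W0.
have mB := measurable_box_set p.
have mwB : measurable_fun (box_set p) (fun x => (w x)%:E).
  exact: measurable_funS measurable_weight.
suff [] : exists2 x, box_set p x & False by [].
apply: (ae_exists mB).
  by rewrite lebesgue_box_set ?lte_fin ?exprn_gt0//; exact: ltW.
have /ae_eq_integral_abs : \int[mu]_(x in box_set p) `|(w x)%:E| = 0.
  by rewrite -W0; apply: eq_integral => x _; rewrite gee0_abs ?weight_ge0.
move=> /(_ mB mwB); apply: filterS => x H /H [] /eqP.
by rewrite gt_eqF.
Qed.

Lemma weight_of_fin_num p : (0 < p.2)%R -> weight_of w (box_set p) \is a fin_num.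
Proof. by move=> p0; rewrite ge0_fin_numE ?lw// ltW// weight_of_gt0. Qed.

(** The closed cube need not lie in Q, but has the same volume and contains the
    half-open one. *)
Lemma weight_average_le_maximal (Q : set (vec R n)) p x : (0 < p.2)%R ->
  measurable Q -> half_open_box p `<=` Q -> half_open_box p x ->
  weight_of w (half_open_box p) * ((p.2 ^+ n)^-1)%:E <= maximal (w \_ Q) x.
Proof.
move=> p0 mQ pQ px.
apply: le_trans (average_le_emaximal _ p0 (half_open_cube_sub px)).
rewrite -/(average _ p) averageE//; apply: lee_wpmul2r.
  by rewrite lee_fin invr_ge0 exprn_ge0// ltW.
have mwQ : measurable_fun setT (fun x => `|(w \_ Q) x|%:E).
  apply/measurable_EFinP; apply: measurableT_comp => //.
  by apply/(measurable_restrictT _ _).1 => //; exact: (@measurable_funS _ _ _ _ setT).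
apply: (@le_trans _ _ (\int[mu]_(x in half_open_box p) `|(w \_ Q) x|%:E)).
  rewrite le_eqVlt; apply/orP; left; apply/eqP; apply: eq_integral => y /set_mem py.
  by rewrite patchE mem_set ?gtr0_norm//; exact: pQ.
apply: ge0_subset_integral => //.
- exact: measurable_half_open_box.
- exact: measurable_box_set.
- exact: (@measurable_funS _ _ _ _ setT).
- exact: half_open_cube_sub.
Qed.

Hypothesis Aw : A_infty w.

Local Notation FW := (fine (fujii_wilson w)).

Lemma fujii_wilson_ge0 : 0 <= fujii_wilson w.
Proof.
pose p : box := (nseq_tuple n 0%R, 1%R).
apply: le_trans (ereal_sup_ubound _) => /=; last first.
  by exists (box_set p) => //; exists p.1, p.2; split=> //=; exact: ltr01.
apply: mule_ge0; last by rewrite inve_ge0 integral_ge0// => x _; exact: weight_ge0.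
by apply: integral_ge0 => x _; exact: emaximal_ge0.
Qed.

Lemma fujii_wilson_fineK : FW%:E = fujii_wilson w.
Proof. by rewrite fineK// ge0_fin_numE// fujii_wilson_ge0. Qed.

Lemma integral_maximal_le p : (0 < p.2)%R ->
  \int[mu]_(x in box_set p) maximal (w \_ (box_set p)) x <=
    FW%:E * weight_of w (box_set p).
Proof.
move=> p0; have Wf := weight_of_fin_num p0; have W0 := weight_of_gt0 p0.
have : \int[mu]_(x in box_set p) maximal (w \_ (box_set p)) x / weight_of w (box_set p)
    <= FW%:E.
  rewrite fujii_wilson_fineK; apply: ereal_sup_ubound.
  by exists (box_set p) => //; exists p.1, p.2.
rewrite -(fineK Wf) inver gt_eqF ?fine_gt0 ?W0 ?ltey_eq ?Wf// lee_pdivrMr//.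
by rewrite fine_gt0// W0 ltey_eq Wf.
Qed.

Variables (f : vec R n -> R) (mf : measurable_fun setT f).
Hypothesis lf : forall p, (0 < p.2)%R -> \int[mu]_(x in box_set p) `|f x|%:E < +oo.
Hypothesis Mf : exists x, maximal f x < +oo.

Section generations_weight.
Variable next : box -> nat -> box.
Hypothesis nextP : forall T, (0 <= T.2)%R -> stopping_family f T (next T).
Local Notation gen := (generation next).

Lemma sum_weight_generation K T : (0 <= T.2)%R ->
  \sum_(0 <= k < K) weight_of w (gen k T) <=
    (2 * FW)%:E * weight_of w (half_open_box T).
Proof.
rewrite le_eqVlt => /predU1P[/esym T0|T0].
  have E k : gen k T = set0.
    apply/seteqP; split => // x /(generation_sub nextP).
    by rewrite T0 (half_open_box_empty n_gt0 T0); exact.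
  rewrite big1 => [|k _]; last by rewrite /weight_of E integral_set0.
  by rewrite (half_open_box_empty n_gt0 T0) /weight_of integral_set0 mule0.
have mv : measurable_fun setT (maximal (w \_ (box_set T))).
  apply: measurable_emaximal => //; apply/measurable_EFinP; apply: measurableT_comp => //.
  apply/(measurable_restrictT _ _).1; first exact: measurable_box_set.
  exact: (@measurable_funS _ _ _ _ setT).
have v0 x : 0 <= maximal (w \_ (box_set T)) x by exact: emaximal_ge0.
have := @carleson R n n_gt0 f next nextP (fun x => (w x)%:E)
  (maximal (w \_ (box_set T))) measurable_weight weight_ge0 mv v0 (box_set T) T K.
move=> /(_ _ (ltW T0) (@half_open_cube_sub _ _ _ _)) /le_trans; apply.
  by move=> p x p0 pT px; apply: weight_average_le_maximal => //; exact: measurable_box_set.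
rewrite EFinM -muleA; apply: lee_wpmul2l => //.
rewrite -weight_of_half_open_box//; apply: le_trans (integral_maximal_le T0).
apply: ge0_subset_integral => //.
- exact: measurable_half_open_box.
- exact: measurable_box_set.
- exact: (@measurable_funS _ _ _ _ setT).
- exact: half_open_cube_sub.
Qed.

(** Generation j + k of T is generation k inside the cubes of generation j, to
    each of which the previous lemma applies. *)
Lemma sum_weight_generation_tail j K T : (0 <= T.2)%R ->
  \sum_(0 <= k < K) weight_of w (gen (j + k) T) <=
    (2 * FW)%:E * weight_of w (gen j T).
Proof.
have W0 A : 0 <= weight_of w A by apply: integral_ge0 => x _; exact: weight_ge0.
elim: j T => [|j IH] T T0; first exact: sum_weight_generation.
have S k : weight_of w (gen k.+1 T) = \sum_(i <oo) weight_of w (gen k (next T i)).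
  by apply: (integral_generationS nextP) => //;
    [exact: measurable_weight|exact: weight_ge0].
rewrite S -nneseriesZl// (_ : \sum_(0 <= k < K) _ =
    \sum_(i <oo) \sum_(0 <= k < K) weight_of w (gen (j + k) (next T i))); last first.
  by rewrite nneseries_sum_nat//; apply: eq_bigr => k _; rewrite addSn S.
apply: lee_nneseries => [i _ _|i _]; first exact: sume_ge0.
by apply: IH; exact: (next_ge0 nextP).
Qed.

End generations_weight.
End borel_weight.

(** * Sufficiency of the A_infty condition *)
Section sufficiency.
Context {R : realType} {n : nat}.
Local Notation mu := (lebesgue_vec R n).
Local Notation box := (vec R n * R)%type.
Implicit Types (q S T : box) (x y : vec R n) (k : nat) (p : R).
Hypothesis n_gt0 : (0 < n)%N.
Variables (w : vec R n -> R) (mw : measurable_fun setT w).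
Hypothesis w_gt0 : forall x, (0 < w x)%R.
Hypothesis lw : forall q, (0 < q.2)%R -> \int[mu]_(x in box_set q) (w x)%:E < +oo.
Hypothesis Aw : A_infty w.
Variables (f : vec R n -> R) (mf : measurable_fun setT f).
Hypothesis lf : forall q, (0 < q.2)%R -> \int[mu]_(x in box_set q) `|f x|%:E < +oo.
Hypothesis Mf : exists x, maximal f x < +oo.
Local Notation step := (@step_constant R n).
Local Notation L := (2 * fine (fujii_wilson w))%R.
Local Notation relative_maximal q x :=
  ((maximal f x - ess_inf_on (box_set q) (maximal f)) / sharp_maximal f x).

(** The increments of the powers of 1 + 1/(2L), arranged so that the first m + 1 of
    them sum up to the power m + 1. *)
Let coef (j : nat) : R :=
  if j is j'.+1 then (L^-1 / 2 * (1 + (2 * L)^-1) ^+ j'.+1)%R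
  else (1 + (2 * L)^-1)%R.

Lemma sum_coef m : (0 < L)%R ->
  (\sum_(0 <= j < m.+1) coef j = (1 + (2 * L)^-1) ^+ m.+1)%R.
Proof.
move=> L0; elim: m => [|m IH]; first by rewrite big_nat1 expr1.
rewrite big_nat_recr//= IH [RHS]exprS.
have -> : ((2 * L)^-1 = L^-1 / 2)%R by rewrite invfM mulrC.
by rewrite -[X in (X + _)%R]mul1r -mulrDl.
Qed.

Let coef_ge0 j : (0 < L)%R -> (0 <= coef j)%R.
Proof.
move=> L0; have r0 : (0 <= 1 + (2 * L)^-1)%R.
  by rewrite addr_ge0// invr_ge0 mulr_ge0// ltW.
by case: j => [//|j]; rewrite /= mulr_ge0 ?exprn_ge0// divr_ge0// invr_ge0 ltW.
Qed.

Section one_box.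
Variables (q : box) (p : R).
Hypotheses (q_gt0 : (0 < q.2)%R) (p_ge1 : (1 <= p)%R).
Variable next : box -> nat -> box.
Hypothesis nextP : forall T, (0 <= T.2)%R -> stopping_family f T (next T).
Local Notation gen k := (generation next k q).
Hypothesis L_ge1 : (1 <= L)%R.

Let L_gt0 : (0 < L)%R. Proof. exact: lt_le_trans L_ge1. Qed.

Let c_ge0 j : (0 <= coef j)%R. Proof. exact: coef_ge0. Qed.

Lemma first_absent_generation x : half_open_box q x ->
  ~ (\bigcap_k gen k) x ->
  exists k, ~ gen k.+1 x /\ forall j, (j <= k)%N -> gen j x.
Proof.
move=> qx nx; have ex : exists k, `[< ~ gen k x >].
  apply: contrapT => H; apply: nx => k _; apply: contrapT => nk.
  by apply: H; exists k; exact/asboolP.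
case: (ex_minnP ex) => -[/asboolP //|k /asboolP nk kmin].
exists k; split=> // j jk; apply: contrapT => nj.
by have := kmin j; rewrite leqNgt ltnS jk => /(_ (asboolT nj)).
Qed.

Lemma relative_maximal_le k x : half_open_box q x ->
  ess_inf_on (box_set q) (maximal f) <= maximal f x ->
  ~ gen k x -> 0 <= relative_maximal q x <= (k%:R * step)%:E.
Proof.
move=> qx mM nk; have c0 := @step_constant_gt0 R n.
apply: ratio_bound => //.
- by rewrite /box_set ess_inf_on_cube//; exact: (floor_maximal_fin_num mf lf Mf q_gt0).
- by rewrite mulr_ge0// ltW.
- exact: sharp_maximal_ge0.
- rewrite /box_set ess_inf_on_cube//.
  exact: (maximal_outside_generation n_gt0 nextP (ltW q_gt0)).
Qed.

Let constant : R := ((step * (3 * L * p)) `^ p)%R.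

Let weighted j := (fun x => (w x)%:E) \_ (gen j).

Let weighted_ge0 j x : 0 <= weighted j x.
Proof. by rewrite /weighted patchE; case: ifP => // _; rewrite lee_fin ltW. Qed.

Let measurable_weighted j : measurable_fun setT (weighted j).
Proof.
apply/(measurable_restrictT _ _).1; first exact: measurable_generation.
exact: (measurable_funS _ _ (measurable_weight mw)).
Qed.

(** If k + 1 is the first generation missing x, the quotient is at most
    (k + 1) c, and the powers of 1 + 1/(2L) up to k + 1 are sums of coefficients
    over the generations that do contain x. *)
Lemma relative_maximal_pow_le x : half_open_box q x ->
  ess_inf_on (box_set q) (maximal f) <= maximal f x ->
  ~ (\bigcap_k gen k) x ->
  (relative_maximal q x) `^ p * (w x)%:E <=
    constant%:E * \sum_(j <oo) (coef j)%:E * weighted j x.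
Proof.
move=> qx mM nx; have [k [nk jk]] := first_absent_generation qx nx.
have c0 := @step_constant_gt0 R n.
have p0 : (0 < p)%R by exact: lt_le_trans p_ge1.
have /andP[u0 uk] := relative_maximal_le qx mM nk.
apply: (@le_trans _ _ (((k.+1%:R * step) `^ p)%:E * (w x)%:E)).
  apply: lee_wpmul2r; first by rewrite lee_fin ltW.
  rewrite -poweR_EFin; apply: gt0_ler_poweR => //; first exact: ltW.
    by rewrite in_itv/= u0 leey.
  by rewrite in_itv/= leey andbT lee_fin mulr_ge0// ltW.
apply: (@le_trans _ _ (constant%:E * (\sum_(0 <= j < k.+1) coef j * w x)%R%:E)).
  rewrite -mulr_suml sum_coef// -!EFinM lee_fin [leRHS]mulrA ler_wpM2r ?(ltW (w_gt0 _))//.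
  rewrite /constant [(k.+1%:R * _)%R]mulrC powRM ?(ltW c0)//; last first.
    by rewrite mulr_ge0 ?(ltW p0)// mulr_ge0 ?(ltW L_gt0).
  rewrite [leLHS]powRM ?(ltW c0)// -[leRHS]mulrA ler_wpM2l ?powR_ge0//.
  exact: powR_le_geometric.
apply: lee_wpmul2l; first by rewrite lee_fin powR_ge0.
rewrite -sumEFin; apply: le_trans (nneseries_lim_ge k.+1 _); last first.
  by move=> j _ _; rewrite mule_ge0// lee_fin.
rewrite big_nat [leRHS]big_nat; apply: lee_sum => j /andP[_ jk'].
by rewrite /weighted patchE mem_set ?EFinM//; exact: jk.
Qed.

Lemma series_coef_le :
  \sum_(j <oo) (coef j)%:E * weight_of w (gen j) <= 2%:E * weight_of w (half_open_box q).
Proof.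
have W0 A : 0 <= weight_of w A by apply: integral_ge0 => x _; rewrite lee_fin ltW.
have q0 := ltW q_gt0.
have Wfin j : weight_of w (gen j) \is a fin_num.
  rewrite ge0_fin_numE//; apply: le_lt_trans (lw q_gt0).
  apply: ge0_subset_integral => //.
  - exact: measurable_generation.
  - exact: measurable_box_set.
  - exact: (measurable_funS _ _ (measurable_weight mw)).
  - by move=> x _; rewrite lee_fin ltW.
  - by move=> x /(generation_sub nextP q0) /half_open_cube_sub.
pose a j := fine (weight_of w (gen j)).
have aE j : weight_of w (gen j) = (a j)%:E by rewrite fineK.
have a0 j : (0 <= a j)%R by rewrite fine_ge0.
have tail j K : (\sum_(0 <= k < K) a (j + k)%N <= L * a j)%R.
  rewrite -lee_fin EFinM -sumEFin -aE.
  under eq_bigr do rewrite -aE.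
  exact: (sum_weight_generation_tail n_gt0 mw w_gt0 lw Aw nextP).
apply: lime_le; first by apply: is_cvg_nneseries => j _ _; rewrite mule_ge0// lee_fin.
apply: nearW => K; apply: (@le_trans _ _ (\sum_(0 <= j < K.+1) (coef j)%:E * weight_of w (gen j))).
  by rewrite big_nat_recr//= leeDl// mule_ge0// lee_fin.
under eq_bigr do rewrite aE -EFinM.
rewrite sumEFin (aE 0%N) -EFinM lee_fin big_nat_recl//.
exact: geometric_sum.
Qed.

Lemma integral_relative_maximal :
  \int[mu]_(x in box_set q) ((relative_maximal q x) `^ p * (w x)%:E) <=
    constant%:E * (2%:E * weight_of w (box_set q)).
Proof.
have C0 : (0 <= constant)%R by exact: powR_ge0.
have mB := measurable_box_set q.
have mwj j : measurable_fun (box_set q) (weighted j).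
  exact: (@measurable_funS _ _ _ _ setT).
have cw0 j x : 0 <= (coef j)%:E * weighted j x by rewrite mule_ge0// lee_fin.
have mcw j : measurable_fun (box_set q) (fun x => (coef j)%:E * weighted j x).
  exact: measurable_funeM.
apply: (@le_trans _ _ (\int[mu]_(x in box_set q)
    (constant%:E * \sum_(j <oo) (coef j)%:E * weighted j x))).
  apply: ae_ge0_le_integral_all.
  - by move=> x _; rewrite mule_ge0 ?poweR_ge0// lee_fin ltW.
  - by move=> x _; rewrite mule_ge0 ?lee_fin//; exact: nneseries_ge0.
  have nullI : {ae mu, forall x, ~ (\bigcap_k gen k) x}.
    apply: negligibleS (null_generations n_gt0 nextP (ltW q_gt0)) => x /= /contrapT.
    exact.
  apply: filterS3 nullI (ae_half_open_cube q.1 q_gt0)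
    (ess_inf_on_ae (box_set q) (maximal f)) => x nx Hx Mx qx.
  exact: relative_maximal_pow_le (Hx qx) (Mx qx) nx.
rewrite ge0_integralZl//=; first 1 last.
- apply: (@ge0_emeasurable_sum _ _ _ (box_set q)
    (fun j x => (coef j)%:E * weighted j x) xpredT) => [j x _ _|j _];
    [exact: cw0|exact: mcw].
- by move=> x _; exact: nneseries_ge0.
apply: lee_wpmul2l; first by rewrite lee_fin.
rewrite integral_nneseries// weight_of_half_open_box//.
apply: le_trans series_coef_le; apply: lee_nneseries => j _.
  by move=> _; exact: integral_ge0.
rewrite ge0_integralZl//=; last by rewrite lee_fin.
rewrite -integral_mkcondr /weight_of setIidr//.
by move=> x /(generation_sub nextP (ltW q_gt0)) /half_open_cube_sub.
Qed.

End one_box.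

(** The constant 12 is 2 * 3 * 2: the first 2 bounds 2^(1/p), the 3 comes from
    powR_le_geometric, and L = 2 [w]. *)
Lemma sufficiency_borel q p : (0 < q.2)%R -> (1 <= p)%R ->
  ratio_norm w f (box_set q) p <= (12 * step)%:E * fujii_wilson w * p%:E.
Proof.
move=> q0 p1.
have fin_floor T := @floor_maximal_fin_num R n f mf lf Mf T.
have /choice[next nextP] : forall T, exists P, (0 <= T.2)%R -> stopping_family f T P.
  move=> T; have [T0|T0] := pselect (0 <= T.2)%R; last by exists (fun=> T).
  by have [P HP] := exists_stopping_family n_gt0 mf lf fin_floor T0; exists P.
have Wfin := weight_of_fin_num mw w_gt0 lw q0.
have W0 := weight_of_gt0 mw w_gt0 q0.
have WE := weight_of_half_open_box mw w_gt0 q0.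
have W00 : (0 < fine (weight_of w (box_set q)))%R by rewrite fine_gt0// W0 ltey_eq Wfin.
(* the sum over one generation is already w(Q), hence L >= 1 *)
have L1 : (1 <= L)%R.
  have := sum_weight_generation n_gt0 mw w_gt0 lw Aw nextP 1 (ltW q0).
  rewrite big_nat1 /= -WE -(fineK Wfin) -EFinM lee_fin.
  by rewrite -{1}[fine (weight_of _ _)]mul1r ler_pM2r.
have c0 := @step_constant_gt0 R n.
pose C := ((step * (3 * L * p)) `^ p)%R.
have C0 : (0 <= C)%R by exact: powR_ge0.
have p0 : (0 < p)%R by exact: lt_le_trans p1.
have L0 : (0 < L)%R by exact: lt_le_trans L1.
have main := integral_relative_maximal q0 p1 nextP L1.
have normle : ratio_norm w f (box_set q) p <= ((C * 2)%:E) `^ p^-1.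
  rewrite /ratio_norm; apply: gt0_ler_poweR; first by rewrite invr_ge0 ltW.
  - rewrite in_itv/= leey andbT mule_ge0 ?inve_ge0 ?(ltW W0)//.
    by apply: integral_ge0 => x _; rewrite mule_ge0 ?poweR_ge0// lee_fin ltW.
  - by rewrite in_itv/= leey andbT lee_fin mulr_ge0.
  - rewrite -(fineK Wfin) inver gt_eqF// lee_pdivrMr//.
    by rewrite (fineK Wfin) EFinM -muleA.
apply: (le_trans normle).
rewrite poweR_EFin -(fujii_wilson_fineK w_gt0 Aw) -!EFinM lee_fin.
rewrite powRM// /C -powRrM divff ?gt_eqF// powRr1; last first.
  by rewrite mulr_ge0 ?(ltW c0)// mulr_ge0 ?(ltW p0)// mulr_ge0 ?(ltW L0).
have : (2 `^ p^-1 <= 2 :> R)%R.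
  rewrite -[leRHS]powRr1//; apply: ler_powR; first by rewrite ler1n.
  by rewrite invf_le1.
move=> H2; apply: (@le_trans _ _ (step * (3 * L * p) * 2)%R).
  rewrite ler_wpM2l//.
  by rewrite mulr_ge0 ?(ltW c0)// mulr_ge0 ?(ltW p0)// mulr_ge0 ?(ltW L0).
by rewrite le_eqVlt; apply/orP; left; apply/eqP; ring.
Qed.

End sufficiency.

(** * Two oscillation estimates *)
Section twice_oscillation.
Context {R : realType} {n : nat}.
Local Notation mu := (lebesgue_vec R n).
Local Notation box := (vec R n * R)%type.
Implicit Types (p q : box) (x y : vec R n).
Variables (f : vec R n -> R) (mf : measurable_fun setT f).
Hypothesis lf : forall p, (0 < p.2)%R -> \int[mu]_(x in box_set p) `|f x|%:E < +oo.

Lemma oscillation_le_twice q (c : R) : (0 < q.2)%R ->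
  average (fun x => `|f x - mean f (box_set q)|%:E) q <=
    2%:E * average (fun x => `|f x - c|%:E) q.
Proof.
move=> q0; have qn0 : (0 < q.2 ^+ n)%R by rewrite exprn_gt0.
have mB := measurable_box_set q.
have muq : mu (box_set q) = (q.2 ^+ n)%:E by exact/lebesgue_box_set/ltW.
have intf : mu.-integrable (box_set q) (EFin \o f).
  apply/integrableP; split; last exact: lf.
  by apply/measurable_EFinP; exact: measurable_funS mf.
have intc : mu.-integrable (box_set q) (EFin \o cst c).
  apply/integrableP; split; first exact: (measurable_cst c%:E).
  have -> : \int[mu]_(x in box_set q) `|(EFin \o cst c) x| = `|c|%:E * (q.2 ^+ n)%:E.
    by rewrite -muq; exact: (integral_cst mu mB `|c|%:E).
  by rewrite -EFinM ltry.
have md := @measurable_deviation R n f mf.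
have mean_sub : (mean f (box_set q) - c = mean (fun x => f x - c) (box_set q))%R.
  have E : (\int[mu]_(x in box_set q) (f x - c) =
      \int[mu]_(x in box_set q) f x - c * q.2 ^+ n)%R.
    rewrite (RintegralB mB intf intc) Rintegral_cst//.
    by congr (_ - _ * _)%R; exact: (congr1 fine muq).
  by rewrite /mean E muq /= mulrBl mulfK// gt_eqF.
pose g x := (f x - c)%R.
have mg : measurable_fun setT g by exact: measurable_funB.
have lg p : (0 < p.2)%R -> \int[mu]_(x in box_set p) `|g x|%:E < +oo.
  move=> p0; apply: (@le_lt_trans _ _ (\int[mu]_(x in box_set p) (`|f x|%:E + `|c|%:E))).
    apply: ae_ge0_le_integral_all => [//|x _|]; first by rewrite -EFinD lee_fin addr_ge0.
    by apply: aeW => x _; rewrite -EFinD lee_fin ler_normB.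
  rewrite ge0_integralD//; last 2 first.
  - exact: measurable_box_set.
  - by apply: (@measurable_funS _ _ _ _ setT) => //; exact: measurable_abs_fun.
  have -> : \int[mu]_(x in box_set p) `|c|%:E = `|c|%:E * (p.2 ^+ n)%:E.
    rewrite -(lebesgue_box_set (ltW p0)).
    by apply: (integral_cst mu _ `|c|%:E); exact: measurable_box_set.
  by apply: lte_add_pinfty; [exact: lf|rewrite -EFinM ltry].
have H := abs_mean_le_average mg lg q0.
rewrite -/g -mean_sub in H.
apply: (@le_trans _ _ (average (fun x => `|g x|%:E + (cst `|mean f (box_set q) - c|%:E) x) q)).
  apply: le_average => // x _; rewrite -EFinD lee_fin /g.
  by rewrite /= [(`|mean f (box_set q) - c|)%R]distrC ler_distD.
rewrite (averageD q0 (md c) (measurable_cst _))//; last first.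
  by move=> x; rewrite lee_fin.
rewrite average_cst// -[2%:E]/((1 + 1)%:E) EFinD ge0_muleDl ?lee_fin// mul1e.
exact: leeD2l.
Qed.

End twice_oscillation.

Section good_lambda.
Context {R : realType} {n : nat}.
Local Notation mu := (lebesgue_vec R n).
Local Notation box := (vec R n * R)%type.
Implicit Types (p q r : box) (x y : vec R n) (k N : nat).
Variables (h : vec R n -> \bar R) (mh : measurable_fun setT h).
Hypothesis h0 : forall x, 0 <= h x.

(** If s <= 3 ^+ n the trivial bound by the measure of r suffices.  Otherwise large
    cubes cannot produce values above t s, and for the small ones the weak type
    inequality is applied to h on the triple of r, whose average is at most t. *)
Lemma good_lambda r y (t s : R) : (0 < r.2)%R -> box_set r y -> (0 < t)%R -> (0 <= s)%R ->
  emaximal h y <= t%:E ->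
  s%:E * mu (box_set r `&` [set x | (t * s)%:E < emaximal h x]) <=
    (9 ^+ n * r.2 ^+ n)%:E.
Proof.
move=> r0 ry t0 s0 hy; set G := [set x | _].
have mG : measurable G by exact: measurable_superlevel.
have mB := measurable_box_set r.
have mBG : measurable (box_set r `&` G) by exact: measurableI.
have rn0 : (0 <= r.2 ^+ n)%R by rewrite exprn_ge0// ltW.
have e9 : (9 ^+ n = 3 ^+ n * 3 ^+ n :> R)%R by rewrite -exprMn -natrM.
have [s3|s3] := leP s (3 ^+ n)%R.
  apply: (@le_trans _ _ ((9 ^+ n)%:E * mu (box_set r))); last first.
    by rewrite lebesgue_box_set ?EFinM//; exact: ltW.
  apply: lee_pmul => //.
    by rewrite lee_fin e9 (le_trans s3)// ler_peMr ?exprn_ge0// exprn_ege1// ler1n.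
  by apply: le_measure; rewrite ?inE//; exact: subIsetl.
pose g := h \_ (box_set (triple_box r)).
have m3 := measurable_box_set (triple_box r).
have mg : measurable_fun setT g.
  apply/(measurable_restrictT _ _).1 => //.
  by apply: (@measurable_funS _ _ _ _ setT).
have g0 x : 0 <= g x by rewrite /g patchE; case: ifP.
have r30 : (0 < (triple_box r).2)%R by rewrite mulr_gt0.
have ts0 : (0 <= t * s)%R by rewrite mulr_ge0// ltW.
have sub : box_set r `&` G `<=` [set x | (t * s)%:E < emaximal g x].
  move=> x [rx /= Gx].
  have := lt_le_trans Gx (emaximal_localize r0 mh h0 rx ry).
  rewrite lt_max => /orP[|//] lt; exfalso; move: lt; apply/negP; rewrite -leNgt.
  apply: (@le_trans _ _ ((3 ^+ n)%:E * t%:E)).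
    by apply: lee_wpmul2l => //; rewrite lee_fin exprn_ge0.
  by rewrite -EFinM lee_fin mulrC ler_wpM2l ?ltW.
have I : \int[mu]_x g x <= (t * (3 ^+ n * r.2 ^+ n))%:E.
  rewrite -integral_mkcond integral_averageE// exprMn [leRHS]EFinM.
  apply: lee_wpmul2r; first by rewrite lee_fin mulr_ge0// exprn_ge0.
  apply: le_trans hy; apply: average_le_emaximal => //.
  exact/(cube_sub_triple_self (ltW r0)).
rewrite -(@lee_pmul2l _ t%:E)// muleA -EFinM.
apply: (@le_trans _ _ ((t * s)%:E * mu [set x | (t * s)%:E < emaximal g x])).
  apply: lee_wpmul2l; first by rewrite lee_fin.
  by apply: le_measure sub; rewrite inE; [exact: mBG|exact: measurable_superlevel].
apply: (le_trans (weak_type mg g0 ts0)).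
apply: (@le_trans _ _ ((3 ^+ n)%:E * (t * (3 ^+ n * r.2 ^+ n))%:E)).
  by apply: lee_wpmul2l => //; rewrite lee_fin exprn_ge0.
by rewrite -EFinM lee_fin e9 le_eqVlt; apply/orP; left; apply/eqP; ring.
Qed.

End good_lambda.

(** * The staircase functions *)
Section staircase.
Context {R : realType} {n : nat}.
Local Notation mu := (lebesgue_vec R n).
Local Notation box := (vec R n * R)%type.
Implicit Types (p r : box) (x y : vec R n) (k N : nat).
Hypothesis n_gt0 : (0 < n)%N.
Variables (h : vec R n -> \bar R) (mh : measurable_fun setT h).
Hypothesis h0 : forall x, 0 <= h x.
Variables (q : box) (q_gt0 : (0 < q.2)%R) (t : R) (t_gt0 : (0 < t)%R).
Hypothesis h_mass : \int[mu]_x h x <= (2 * t * q.2 ^+ n)%:E.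
Hypothesis h_large : forall x, box_set q x -> t%:E < emaximal h x.

Definition level k := [set x | (t * 2 ^+ k)%:E < emaximal h x].

(** A discrete version of the positive part of log_2 (M h / t), truncated at N. *)
Definition staircase N x : R := (\sum_(0 <= k < N) \1_(level k) x)%R.

Lemma measurable_level k : measurable (level k).
Proof. exact: measurable_superlevel. Qed.

Lemma level_decr j k x : (j <= k)%N -> level k x -> level j x.
Proof.
move=> jk; apply: le_lt_trans.
by rewrite lee_fin ler_pM2l// ler_eXn2l// ltr1n.
Qed.

Lemma lebesgue_level k : mu (level k) <= (2 * 3 ^+ n * q.2 ^+ n * 2^-1 ^+ k)%:E.
Proof.
have t2 : (0 < t * 2 ^+ k)%R by rewrite mulr_gt0// exprn_gt0.
rewrite -(@lee_pmul2l _ (t * 2 ^+ k)%:E)//.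
apply: (le_trans (weak_type mh h0 (ltW t2))).
apply: (@le_trans _ _ ((3 ^+ n)%:E * (2 * t * q.2 ^+ n)%:E)).
  by apply: lee_wpmul2l => //; rewrite lee_fin exprn_ge0.
have e2 : (2 ^+ k * 2^-1 ^+ k = 1 :> R)%R by rewrite -exprMn divff// expr1n.
rewrite -!EFinM lee_fin [leRHS](_ : _ =
   t * (2 * 3 ^+ n * q.2 ^+ n) * (2 ^+ k * 2^-1 ^+ k))%R; last by ring.
by rewrite e2 mulr1 le_eqVlt; apply/orP; left; apply/eqP; ring.
Qed.

Lemma measurable_staircase N : measurable_fun setT (staircase N).
Proof.
apply: measurable_sum => k.
by apply: measurable_indic; exact: measurable_level.
Qed.

Lemma staircase_ge0 N x : (0 <= staircase N x)%R.
Proof. by apply: sumr_ge0 => k _. Qed.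

Lemma staircase_le N x : (staircase N x <= N%:R)%R.
Proof.
apply: (@le_trans _ _ (\sum_(0 <= k < N) 1)%R); last by rewrite sumr_const_nat subn0.
by apply: ler_sum => k _; rewrite indicE; case: (_ \in _).
Qed.

Lemma staircase_ge N j x : (j <= N)%N -> (forall k, (k < j)%N -> level k x) ->
  (j%:R <= staircase N x)%R.
Proof.
move=> jN H; rewrite /staircase (big_cat_nat (leq0n j) jN)/=.
rewrite (@eq_big_nat _ _ _ 0 j _ (fun=> 1%R)); last first.
  by move=> k kj; rewrite indicE mem_set//; exact: H.
by rewrite sumr_const_nat subn0 lerDl; apply: sumr_ge0.
Qed.

(** The conclusion covers the case where P holds below N, with j = N. *)
Lemma first_missed_level N (P : nat -> Prop) : exists j,
  [/\ (j <= N)%N, forall k, (k < j)%N -> P k & (j < N)%N -> ~ P j].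
Proof.
have ex : exists j, (N <= j)%N || `[< ~ P j >] by exists N; rewrite leqnn.
case: (ex_minnP ex) => j Pj jmin; exists j; split.
- by apply: jmin; rewrite leqnn.
- move=> k kj; apply: contrapT => nk; have := jmin k.
  by rewrite (asboolT nk) orbT leqNgt kj => /(_ isT).
- by move=> jN; move: Pj; rewrite leqNgt jN => /asboolP.
Qed.

Lemma staircase_const N j x : (j <= N)%N -> (forall k, (k < j)%N -> level k x) ->
  staircase N x = (j%:R + \sum_(j <= k < N) \1_(level k) x)%R.
Proof.
move=> jN H; rewrite /staircase (big_cat_nat (leq0n j) jN)/=; congr (_ + _)%R.
rewrite (@eq_big_nat _ _ _ 0 j _ (fun=> 1%R)); last first.
  by move=> k kj; rewrite indicE mem_set//; exact: H.
by rewrite sumr_const_nat subn0.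
Qed.

Lemma staircase_integrable N p : (0 < p.2)%R ->
  \int[mu]_(x in box_set p) `|staircase N x|%:E < +oo.
Proof.
move=> p0; apply: (@le_lt_trans _ _ (N%:R%:E * (p.2 ^+ n)%:E)); last by rewrite -EFinM ltry.
rewrite -(lebesgue_box_set (ltW p0)).
rewrite -(integral_cst mu (measurable_box_set p) N%:R%:E).
apply: ae_ge0_le_integral_all => [//|x _|]; first by rewrite lee_fin.
by apply: aeW => x _; rewrite lee_fin ger0_norm ?staircase_ge0// staircase_le.
Qed.

Lemma staircase_locally_integrable N : locally_integrable_vec (staircase N).
Proof.
split; last by move=> _ [a [r [r0 ->]]]; exact: (@staircase_integrable N (a, r)).
by exists (staircase N); [exact: measurable_staircase|exact: aeW].
Qed.

Lemma maximal_staircase_le N x : maximal (staircase N) x <= N%:R%:E.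
Proof.
apply/emaximal_leP => p p0 _; rewrite -(average_cst N%:R p0).
apply: le_average => // y _; rewrite lee_fin ger0_norm ?staircase_ge0//.
exact: staircase_le.
Qed.

(** Superlevel sets of M h are open, so the staircase is at least its value at x on
    a small cube with corner x. *)
Lemma staircase_le_maximal N x : (staircase N x)%:E <= maximal (staircase N) x.
Proof.
have [j [jN lj nj]] := first_missed_level N (fun k => level k x).
have E : staircase N x = j%:R.
  rewrite (staircase_const jN lj) big_nat big1 ?addr0// => k /andP[jk kN].
  rewrite indicE memNset// => /(level_decr jk).
  exact/nj/(leq_ltn_trans jk).
rewrite E; case: j => [|j] in jN lj {nj} E *; first exact: emaximal_ge0.
have [e e0 He] := open_superlevel mh h0 (lj j (ltnSn j)).
have e2 : (0 < e / 2)%R by rewrite divr_gt0.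
have px : box_set (x, e / 2)%R x by move=> i /=; rewrite lexx lerDl ltW.
apply: le_trans (average_le_emaximal _ _ px) => //.
rewrite -/(average _ _) -(average_cst j.+1%:R (p := (x, e / 2)%R))//.
apply: le_average => [//|y _|y xy]; first by rewrite lee_fin.
rewrite lee_fin ger0_norm ?staircase_ge0//;
apply: staircase_ge => // k kj; apply: (@level_decr k j) => //.
apply: He => i; have /andP[/= ? ?] := xy i.
by rewrite ltr_norml; apply/andP; split; lra.
Qed.


Lemma sum_half_le j N : (j <= N)%N ->
  (\sum_(j <= k < N) 2^-1 ^+ (k - j) <= 2 :> R)%R.
Proof.
move=> jN; rewrite -{1}[j]add0n big_addn.
under eq_bigr do rewrite addnK.
suff -> : (\sum_(0 <= k < N - j) 2^-1 ^+ k = 2 - 2 * 2^-1 ^+ (N - j) :> R)%R.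
  by rewrite gerBl mulr_ge0// exprn_ge0// invr_ge0.
elim: (N - j)%N => [|m IH]; first by rewrite big_geq// expr0; lra.
by rewrite big_nat_recr//= IH exprS; field.
Qed.

Lemma integral_staircase N :
  \int[mu]_x `|staircase N x|%:E <= (4 * 3 ^+ n * q.2 ^+ n)%:E.
Proof.
have -> : \int[mu]_x `|staircase N x|%:E = \sum_(0 <= k < N) mu (level k).
  under eq_integral do rewrite ger0_norm ?staircase_ge0// /staircase -sumEFin.
  rewrite ge0_integral_sum//.
    apply: eq_bigr => k _; rewrite integral_indic ?setIT//.
    exact: measurable_level.
  move=> k; apply/measurable_EFinP; apply: measurable_indic; exact: measurable_level.
apply: (@le_trans _ _ (\sum_(0 <= k < N) (2 * 3 ^+ n * q.2 ^+ n * 2^-1 ^+ k)%:E)).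
  by apply: lee_sum => k _; exact: lebesgue_level.
rewrite sumEFin lee_fin -mulr_sumr.
have := sum_half_le (leq0n N); under eq_bigr do rewrite subn0.
have c0 : (0 <= 2 * 3 ^+ n * q.2 ^+ n)%R by rewrite !mulr_ge0// exprn_ge0// ltW.
move=> /(ler_wpM2l c0) /le_trans; apply.
by rewrite le_eqVlt; apply/orP; left; apply/eqP; ring.
Qed.

Lemma measurable_abs_staircase N : measurable_fun setT (fun x => `|staircase N x|%:E).
Proof. by apply: measurable_abs_fun; exact: measurable_staircase. Qed.

(** The staircase has integral at most 4 * 3 ^+ n * |q|, so by the weak type
    inequality M of it exceeds the bound on at most half of q. *)
Lemma ess_inf_maximal_staircase N :
  ess_inf_on (box_set q) (maximal (staircase N)) <= (8 * 9 ^+ n)%:E.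
Proof.
set A : R := (8 * 9 ^+ n)%R.
have A0 : (0 < A)%R by rewrite mulr_gt0// exprn_gt0.
have e9 : (9 ^+ n = 3 ^+ n * 3 ^+ n :> R)%R by rewrite -exprMn -natrM.
have qn0 : (0 < q.2 ^+ n)%R by rewrite exprn_gt0.
have mM := measurable_superlevel (measurable_abs_staircase N) (fun=> normr_ge0 _) A.
have small : mu [set x | A%:E < maximal (staircase N) x] <= (2^-1 * q.2 ^+ n)%:E.
  rewrite -(@lee_pmul2l _ A%:E)//.
  apply: (le_trans (weak_type (measurable_abs_staircase N) (fun=> normr_ge0 _) (ltW A0))).
  apply: (@le_trans _ _ ((3 ^+ n)%:E * (4 * 3 ^+ n * q.2 ^+ n)%:E)).
    by apply: lee_wpmul2l; [rewrite lee_fin exprn_ge0|exact: integral_staircase].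
  by rewrite -!EFinM lee_fin /A e9 le_eqVlt; apply/orP; left; apply/eqP; field.
rewrite leNgt; apply/negP => lt.
have mB := measurable_box_set q.
have : mu (box_set q) <= mu [set x | A%:E < maximal (staircase N) x].
  have [Z [mZ Z0 HZ]] := ess_inf_on_ae (box_set q) (maximal (staircase N)).
  rewrite -[leRHS]adde0 -Z0; apply: le_trans (measureU2 _ mM mZ).
  apply: le_measure; rewrite ?inE; [exact: mB|exact: measurableU|].
  move=> x qx; have [Zx|nZx] := pselect (Z x); [by right|left].
  apply: (lt_le_trans lt); apply: contrapT => H; apply: nZx; apply: HZ => /= H'.
  exact/H/H'.
move=> /le_trans /(_ small); rewrite lebesgue_box_set; last exact: ltW.
by rewrite lee_fin leNgt gtr_pMl// invf_lt1// ltr1n.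
Qed.

(** Let j be the first level that does not contain all of r.  On r the staircase is
    j plus the levels from j on, and the good-lambda inequality at a point of r
    outside level j bounds the proportion of level k in r by
    9 ^+ n * 2 ^- (k - j). *)
Lemma oscillation_staircase N r : (0 < r.2)%R ->
  average (fun x => `|staircase N x - mean (staircase N) (box_set r)|%:E) r <=
    (4 * 9 ^+ n)%:E.
Proof.
move=> r0; have mB := measurable_box_set r.
have rn0 : (0 < r.2 ^+ n)%R by rewrite exprn_gt0.
have [j [jN lj nj]] := first_missed_level N (fun k => box_set r `<=` level k).
have E x : box_set r x -> (staircase N x - j%:R = \sum_(j <= k < N) \1_(level k) x)%R.
  move=> rx; rewrite (staircase_const jN) => [|k kj]; last exact: lj.
  by rewrite addrC addKr.
apply: (le_trans (oscillation_le_twice (measurable_staircase N) (@staircase_integrable N) j%:R r0)).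
rewrite (_ : 4 * 9 ^+ n = 2 * (2 * 9 ^+ n))%R; last by ring.
rewrite [leRHS]EFinM; apply: lee_wpmul2l => //.
rewrite averageE// lee_pdivrMr//.
have -> : \int[mu]_(x in box_set r) `|staircase N x - j%:R|%:E =
    \sum_(j <= k < N) mu (box_set r `&` level k).
  transitivity (\int[mu]_(x in box_set r) \sum_(j <= k < N) (\1_(level k) x)%:E).
    apply: eq_integral => x /set_mem rx; rewrite E// sumEFin ger0_norm//.
    by apply: sumr_ge0 => k _.
  rewrite ge0_integral_sum//.
    apply: eq_bigr => k _; rewrite integral_indic//; last exact: measurable_level.
    by rewrite setIC.
  move=> k; apply/measurable_EFinP; apply: measurable_indic; exact: measurable_level.
apply: (@le_trans _ _ (\sum_(j <= k < N) (9 ^+ n * r.2 ^+ n * 2^-1 ^+ (k - j))%:E)).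
  rewrite big_nat [leRHS]big_nat; apply: lee_sum => k /andP[jk kN].
  have [y ry ly] : exists2 y, box_set r y & ~ level j y.
    apply: contrapT => /forall2NP H; apply: (nj (leq_ltn_trans jk kN)) => y ry.
    by have [//|/contrapT] := H y.
  have t2 : (0 < t * 2 ^+ j)%R by rewrite mulr_gt0// exprn_gt0.
  have s2 : (0 <= 2 ^+ (k - j) :> R)%R by rewrite exprn_ge0.
  have hy : emaximal h y <= (t * 2 ^+ j)%:E by rewrite leNgt; exact/negP.
  have := good_lambda mh h0 r0 ry t2 s2 hy.
  rewrite -mulrA -exprD subnKC// => H.
  have e2 : (2 ^+ (k - j) * 2^-1 ^+ (k - j) = 1 :> R)%R by rewrite -exprMn divff// expr1n.
  rewrite -(@lee_pmul2l _ (2 ^+ (k - j))%:E) ?lte_fin ?exprn_gt0//.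
  by rewrite -EFinM mulrCA e2 mulr1.
rewrite sumEFin lee_fin -mulr_sumr.
have c0 : (0 <= 9 ^+ n * r.2 ^+ n)%R by rewrite mulr_ge0// ?exprn_ge0// ltW.
apply: (le_trans (ler_wpM2l c0 (sum_half_le jN))).
by rewrite le_eqVlt; apply/orP; left; apply/eqP; ring.
Qed.

Lemma sharp_maximal_staircase N x : sharp_maximal (staircase N) x <= (4 * 9 ^+ n)%:E.
Proof.
apply: ge_ereal_sup => _ [_ [[a [r [r0 ->]]] _] <-].
exact: (@oscillation_staircase N (a, r)).
Qed.

(** The staircase is at least 1 on q and vanishes off level 0, which has finite
    measure and hence cannot fill a large cube. *)
Lemma nonconstant_staircase N : (0 < N)%N -> nonconstant (staircase N).
Proof.
move=> N0 [c cE].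
have c1 : (1 <= c)%R.
  have mB := measurable_box_set q.
  have [||x qx <-] := @ae_exists R n (box_set q) (fun x => staircase N x = c) mB.
  - by rewrite lebesgue_box_set ?lte_fin ?exprn_gt0//; exact: ltW.
  - by apply: filterS cE => x.
  apply: (@staircase_ge N 1) => // k; rewrite ltnS leqn0 => /eqP ->.
  by rewrite /level /= expr0 mulr1; exact: h_large.
pose s := (Num.bound (2 * 3 ^+ n * q.2 ^+ n))%:R%R : R.
have m0 : (0 <= 2 * 3 ^+ n * q.2 ^+ n)%R by rewrite !mulr_ge0// exprn_ge0// ltW.
have s_gt : (2 * 3 ^+ n * q.2 ^+ n < s)%R by exact: archi_boundP.
have s0 : (0 < s)%R by exact: le_lt_trans s_gt.
have s1 : (1 <= s)%R by rewrite -[1%R]/(1%:R) ler_nat -(ltr_nat R) mulr0n.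
pose p : box := (q.1, s).
have mp := measurable_box_set p.
have : mu (box_set p) <= mu (level 0).
  have [Z [mZ Z0 HZ]] := cE.
  have ml0 := measurable_level 0.
  rewrite -[leRHS]adde0 -Z0; apply: le_trans (measureU2 _ ml0 mZ).
  apply: le_measure; rewrite ?inE; [exact: mp|exact: measurableU|].
  move=> x _; have [Zx|nZx] := pselect (Z x); [by right|left].
  apply: contrapT => nl; apply: nZx; apply: HZ => /= xc.
  move: c1; rewrite -xc leNgt => /negP; apply.
  rewrite /staircase big1 ?ltr01// => k _.
  by rewrite indicE memNset// => /(level_decr (leq0n k)).
move=> /le_trans /(_ (lebesgue_level 0)).
rewrite lebesgue_box_set; last exact: ltW.
rewrite /= lee_fin expr0 mulr1 leNgt => /negP; apply.
by apply: (lt_le_trans s_gt); rewrite ler_eXnr.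
Qed.

End staircase.

(** * Necessity of the A_infty condition *)
Section ratio_lower.
Context {R : realType}.
Implicit Types (M m s : \bar R) (f A B : R).

(** When s = 0 the quotient is infinite unless M = m, in which case f <= A. *)
Lemma ratio_lower M m s f A B : m \is a fin_num -> M \is a fin_num ->
  0 <= s <= B%:E -> (0 < B)%R -> m <= M -> f%:E <= M -> m <= A%:E ->
  (Num.max (f - A) 0 / B)%:E <= (M - m) / s.
Proof.
case: m => // m _; case: M => // M _; case: s => [s| |]//; last by rewrite leye_eq andbF.
rewrite !lee_fin -EFinB => /andP[s0 sB] B0 mM fM mA.
have max0 : (0 <= Num.max (f - A) 0)%R by rewrite le_max lexx orbT.
have maxM : (Num.max (f - A) 0 <= M - m)%R.
  by rewrite ge_max subr_ge0 mM andbT; lra.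
move: s0; rewrite le_eqVlt => /predU1P[<-|s0].
  rewrite inve0; have [Mm|Mm] := ltP 0%R (M - m)%R; first by rewrite gt0_muley ?leey.
  rewrite (_ : Num.max (f - A) 0 = 0)%R; last first.
    by apply/eqP; rewrite eq_le max0 andbT (le_trans maxM).
  by rewrite mul0r mule_ge0// lee_fin subr_ge0.
rewrite inver gt_eqF// -EFinM lee_fin; apply: ler_pM => //.
  by rewrite invr_ge0 ltW.
by rewrite lef_pV2 ?posrE.
Qed.

End ratio_lower.

Section necessity.
Context {R : realType} {n : nat}.
Local Notation mu := (lebesgue_vec R n).
Local Notation box := (vec R n * R)%type.
Implicit Types (q : box) (x y : vec R n) (k N : nat).
Hypothesis n_gt0 : (0 < n)%N.
Variables (w : vec R n -> R) (mw : measurable_fun setT w).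
Hypothesis w_gt0 : forall x, (0 < w x)%R.
Hypothesis lw : forall q, (0 < q.2)%R -> \int[mu]_(x in box_set q) (w x)%:E < +oo.
Variable C : R.
Hypothesis HC : forall f : vec R n -> R,
  locally_integrable_vec f -> nonconstant f -> ~ (forall x, maximal f x = +oo) ->
  forall (Q : set (vec R n)) (p : R), is_cube Q -> (1 <= p)%R ->
  ratio_norm w f Q p <= (C * p)%:E.

Let A : R := (8 * 9 ^+ n)%R.
Let B : R := (4 * 9 ^+ n)%R.
Let B_gt0 : (0 < B)%R. Proof. by rewrite mulr_gt0// exprn_gt0. Qed.
Let A_gt0 : (0 < A)%R. Proof. by rewrite mulr_gt0// exprn_gt0. Qed.

Section test_function.
Variables (h : vec R n -> \bar R) (mh : measurable_fun setT h).
Hypothesis h0 : forall x, 0 <= h x.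
Variables (q : box) (q_gt0 : (0 < q.2)%R) (t : R) (t_gt0 : (0 < t)%R).
Hypothesis h_mass : \int[mu]_x h x <= (2 * t * q.2 ^+ n)%:E.
Hypothesis h_large : forall x, box_set q x -> t%:E < emaximal h x.
Local Notation st := (staircase h t).

(** The excess over A is kept as a Borel function below the quotient; its integral
    is therefore controlled by the assumed estimate with p = 1. *)
Lemma staircase_excess N : (0 < N)%N ->
  \int[mu]_(x in box_set q) (Num.max (st N x - A) 0 / B * w x)%:E <=
    C%:E * weight_of w (box_set q).
Proof.
move=> N0.
have Wfin := weight_of_fin_num mw w_gt0 lw q_gt0.
have W0 := weight_of_gt0 mw w_gt0 q_gt0.
have W00 : (0 < fine (weight_of w (box_set q)))%R by rewrite fine_gt0// W0 ltey_eq Wfin.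
have Mle x := maximal_staircase_le h t N x.
have M0 x : 0 <= maximal (st N) x by exact: emaximal_ge0.
have Mfin x : maximal (st N) x \is a fin_num.
  by rewrite ge0_fin_numE//; exact: le_lt_trans (Mle x) (ltry _).
have rn := HC (staircase_locally_integrable mh h0 t N)
  (nonconstant_staircase n_gt0 mh h0 q_gt0 t_gt0 h_mass h_large N0).
have {}rn : ratio_norm w (st N) (box_set q) 1 <= C%:E.
  rewrite -[C]mulr1; apply: rn => //; last by exists q.1, q.2.
  by move=> /(_ q.1) My; have := Mfin q.1; rewrite My.
pose u x := (maximal (st N) x - ess_inf_on (box_set q) (maximal (st N))) /
  sharp_maximal (st N) x.
have up : \int[mu]_(x in box_set q) (u x `^ 1 * (w x)%:E) <= C%:E * weight_of w (box_set q).
  have I0 : 0 <= \int[mu]_(x in box_set q) (u x `^ 1 * (w x)%:E).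
    by apply: integral_ge0 => x _; rewrite mule_ge0 ?poweR_ge0// lee_fin ltW.
  move: rn; rewrite /ratio_norm -/(u _) invr1 poweRe1; last first.
    by rewrite mule_ge0// inve_ge0 ltW.
  by rewrite -{1}(fineK Wfin) inver gt_eqF// lee_pdivrMr// (fineK Wfin).
apply: le_trans up; apply: ae_ge0_le_integral_all.
- move=> x _; rewrite lee_fin mulr_ge0 ?(ltW (w_gt0 _))// divr_ge0 ?(ltW B_gt0)//.
  by rewrite le_max lexx orbT.
- by move=> x _; rewrite mule_ge0 ?poweR_ge0// lee_fin ltW.
apply: filterS (ess_inf_on_ae (box_set q) (maximal (st N))) => x Mx qx.
rewrite EFinM; apply: lee_wpmul2r; first by rewrite lee_fin ltW.
have m_le : ess_inf_on (box_set q) (maximal (st N)) <= A%:E.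
  exact: (ess_inf_maximal_staircase mh h0 q_gt0 t_gt0 h_mass).
have mfin : ess_inf_on (box_set q) (maximal (st N)) \is a fin_num.
  rewrite ge0_fin_numE; first exact: le_lt_trans m_le (ltry _).
  by apply: le_ess_inf_on; apply: aeW.
have lower : (Num.max (st N x - A) 0 / B)%:E <= u x.
  apply: ratio_lower => //.
  - by rewrite sharp_maximal_ge0 (sharp_maximal_staircase mh h0 t_gt0).
  - exact: Mx.
  - exact: staircase_le_maximal.
rewrite poweRe1//; apply: le_trans lower.
by rewrite lee_fin divr_ge0 ?(ltW B_gt0)// le_max lexx orbT.
Qed.

Lemma measurable_excess N :
  measurable_fun setT (fun x => (Num.max (st N x - A) 0 / B * w x)%:E).
Proof.
apply/measurable_EFinP; apply: measurable_funM => //; apply: measurable_funM => //.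
apply: measurable_maxr => //; apply: measurable_funB => //.
exact: measurable_staircase.
Qed.

Lemma integral_staircase_weight N : (0 < N)%N ->
  \int[mu]_(x in box_set q) (st N x * w x)%:E <=
    (A + B * C)%:E * weight_of w (box_set q).
Proof.
move=> N0; have mB := measurable_box_set q.
have Wfin := weight_of_fin_num mw w_gt0 lw q_gt0.
have mww : measurable_fun (box_set q) (fun x => (w x)%:E).
  exact: (measurable_funS _ _ (measurable_weight mw)).
have mexc : measurable_fun (box_set q) (fun x => (Num.max (st N x - A) 0 / B * w x)%:E).
  exact: (measurable_funS _ _ (measurable_excess N)).
have exc0 x : (0 <= Num.max (st N x - A) 0 / B * w x)%R.
  by rewrite mulr_ge0 ?(ltW (w_gt0 _))// divr_ge0 ?(ltW B_gt0)// le_max lexx orbT.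
apply: (@le_trans _ _ (\int[mu]_(x in box_set q)
    (A%:E * (w x)%:E + B%:E * (Num.max (st N x - A) 0 / B * w x)%:E))).
  apply: ae_ge0_le_integral_all.
  - by move=> x _; rewrite lee_fin mulr_ge0 ?staircase_ge0// ltW.
  - move=> x _; rewrite adde_ge0// -EFinM lee_fin mulr_ge0 ?(ltW A_gt0) ?(ltW B_gt0)//.
    exact: ltW.
  - apply: aeW => x _; rewrite -!EFinM -EFinD lee_fin.
    rewrite [(B * _)%R](_ : _ = Num.max (st N x - A) 0 * w x)%R; last first.
      by field; rewrite gt_eqF.
    rewrite -mulrDl ler_wpM2r ?(ltW (w_gt0 _))//.
    have : (st N x - A <= Num.max (st N x - A) 0)%R by rewrite le_max lexx.
    lra.
rewrite ge0_integralD//; first last.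
- exact: measurable_funeM.
- by move=> x _; rewrite -EFinM lee_fin mulr_ge0 ?(ltW B_gt0).
- exact: measurable_funeM.
- by move=> x _; rewrite -EFinM lee_fin mulr_ge0 ?(ltW A_gt0)// ltW.
rewrite !ge0_integralZl//; first last.
- by rewrite lee_fin ltW.
- by move=> x _; rewrite lee_fin ltW.
- by rewrite lee_fin ltW.
- by move=> x _; rewrite lee_fin.
rewrite -/(weight_of w (box_set q)).
apply: (@le_trans _ _ (A%:E * weight_of w (box_set q) + B%:E * (C%:E * weight_of w (box_set q)))).
  apply: leeD2l; apply: lee_wpmul2l; first by rewrite lee_fin ltW.
  exact: staircase_excess.
by rewrite -(fineK Wfin) -!EFinM -EFinD lee_fin mulrDl mulrA.
Qed.

End test_function.

(** Here h is the weight restricted to Q, and t is half of its average over Q, so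
    that M h > t on Q. *)
Section local_weight.
Variables (q : box) (q_gt0 : (0 < q.2)%R).
Let Q := box_set q.
Let h : vec R n -> \bar R := fun x => `|(w \_ Q) x|%:E.
Let t : R := (fine (weight_of w Q) / (2 * q.2 ^+ n))%R.

Let qn_gt0 : (0 < q.2 ^+ n)%R. Proof. by rewrite exprn_gt0. Qed.

Let W_gt0 : (0 < fine (weight_of w Q))%R.
Proof. by rewrite fine_gt0// weight_of_gt0//= ltey_eq weight_of_fin_num. Qed.

Let WK : (fine (weight_of w Q))%:E = weight_of w Q.
Proof. by rewrite fineK// weight_of_fin_num. Qed.

Let t_gt0 : (0 < t)%R. Proof. by rewrite divr_gt0// mulr_gt0. Qed.

Let h0 x : 0 <= h x. Proof. by rewrite lee_fin. Qed.

Let mQ : measurable Q. Proof. exact: measurable_box_set. Qed.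

Let mh : measurable_fun setT h.
Proof.
apply/measurable_EFinP; apply: measurableT_comp => //.
by apply/(measurable_restrictT _ _).1 => //; exact: (@measurable_funS _ _ _ _ setT).
Qed.

Let hE : h = (fun x => (w x)%:E) \_ Q.
Proof.
apply/funext => x; rewrite /h !patchE; case: ifP => _; last by rewrite normr0.
by rewrite gtr0_norm.
Qed.

Let integral_h (D : set (vec R n)) :
  \int[mu]_(x in D) h x = \int[mu]_(x in D `&` Q) (w x)%:E.
Proof. by rewrite integral_mkcondr hE. Qed.

Let h_mass : \int[mu]_x h x = (2 * t * q.2 ^+ n)%:E.
Proof.
rewrite integral_h setTI -/(weight_of w Q) -WK; congr EFin.
by rewrite /t; field; rewrite gt_eqF.
Qed.

Let h_large x : box_set q x -> t%:E < emaximal h x.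
Proof.
move=> qx; apply/emaximal_gtP; exists q => //.
rewrite integral_h setIid -/(weight_of w Q) -WK lte_fin /t.
rewrite [ltLHS](_ : _ = 2^-1 * fine (weight_of w Q))%R; last first.
  by field; rewrite gt_eqF.
by rewrite gtr_pMl// invf_lt1// ltr1n.
Qed.

Let h_mass_le : \int[mu]_x h x <= (2 * t * q.2 ^+ n)%:E.
Proof. by rewrite h_mass. Qed.

Local Notation lev := (level h t).

(** If m is the first level missing x, then M h x <= t 2^m, which is t plus the sum
    of t 2^k for k < m. *)
Lemma emaximal_le_layers x : emaximal h x <=
  t%:E + \sum_(k <oo) (t * 2 ^+ k)%:E * (\1_(lev k) x)%:E.
Proof.
have term0 k : 0 <= (t * 2 ^+ k)%:E * (\1_(lev k) x)%:E :> \bar R.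
  by rewrite mule_ge0// lee_fin mulr_ge0 ?exprn_ge0// ltW.
have H m : (forall k, (k < m)%N -> lev k x) ->
    (t * 2 ^+ m)%:E <= t%:E + \sum_(k <oo) (t * 2 ^+ k)%:E * (\1_(lev k) x)%:E.
  move=> lx.
  apply: (@le_trans _ _ (t%:E + \sum_(0 <= k < m) (t * 2 ^+ k)%:E * (\1_(lev k) x)%:E)); last first.
    by apply: leeD2l; apply: nneseries_lim_ge => k _ _.
  rewrite (@eq_big_nat _ _ _ 0 m _ (fun k => (t * 2 ^+ k)%:E)); last first.
    by move=> k km; rewrite indicE mem_set ?mule1//; exact: lx.
  rewrite sumEFin -EFinD lee_fin le_eqVlt; apply/orP; left; apply/eqP.
  elim: (m) => [|i IH]; first by rewrite big_geq// expr0; lra.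
  by rewrite big_nat_recr//= addrA -IH exprS; ring.
have [lx|nlx] := pselect (forall k, lev k x).
  set S := leRHS; suff -> : S = +oo by rewrite leey.
  apply/eqyP => r r0; apply: le_trans (H (Num.bound (r / t)) (fun k _ => lx k)).
  by rewrite lee_fin mulrC -ler_pdivrMr//; exact/ltW/upper_nthrootP.
have ex : exists k, `[< ~ lev k x >].
  apply: contrapT => H'; apply: nlx => k; apply: contrapT => nk.
  by apply: H'; exists k; exact/asboolP.
case: (ex_minnP ex) => m /asboolP nm mmin.
apply: le_trans (H m _); first by rewrite leNgt; exact/negP.
move=> k km; apply: contrapT => nk.
by have := mmin k (asboolT nk); rewrite leqNgt km.
Qed.

Lemma sum_integral_level N : \sum_(0 <= k < N) \int[mu]_(x in lev k) h x <=
  (A + B * C)%:E * weight_of w Q.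
Proof.
apply: (@le_trans _ _ (\sum_(0 <= k < N.+1) \int[mu]_(x in lev k) h x)).
  by rewrite big_nat_recr//= leeDl// integral_ge0.
apply: le_trans (integral_staircase_weight mh h0 q_gt0 t_gt0 h_mass_le h_large (ltn0Sn N)).
have -> : \sum_(0 <= k < N.+1) \int[mu]_(x in lev k) h x =
    \sum_(0 <= k < N.+1) \int[mu]_(x in Q) (\1_(lev k) x * w x)%:E.
  apply: eq_bigr => k _; rewrite integral_h setIC integral_mkcondr.
  apply: eq_integral => x _; rewrite patchE indicE.
  by case: ifP => _; rewrite ?mul1r ?mul0r.
rewrite -ge0_integral_sum//; first last.
- by move=> k x _; rewrite lee_fin mulr_ge0// ltW.
- move=> k; apply/measurable_EFinP; apply: measurable_funM.
    by apply: measurable_indic; exact: measurable_level.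
  exact: (@measurable_funS _ _ _ _ setT).
rewrite le_eqVlt; apply/orP; left; apply/eqP; apply: eq_integral => x _.
by rewrite sumEFin -mulr_suml.
Qed.

Lemma integral_maximal_weight :
  \int[mu]_(x in Q) maximal (w \_ Q) x <= (2^-1 + 3 ^+ n * (A + B * C))%:E * weight_of w Q.
Proof.
have mind k : measurable_fun Q (fun x => (t * 2 ^+ k)%:E * (\1_(lev k) x)%:E).
  apply: measurable_funeM; apply/measurable_EFinP; apply: measurable_indic.
  exact: measurable_level.
have term0 k x : 0 <= (t * 2 ^+ k)%:E * (\1_(lev k) x)%:E :> \bar R.
  by rewrite mule_ge0// lee_fin mulr_ge0 ?exprn_ge0// ltW.
apply: (@le_trans _ _ (\int[mu]_(x in Q)
    (t%:E + \sum_(k <oo) (t * 2 ^+ k)%:E * (\1_(lev k) x)%:E))).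
  apply: ae_ge0_le_integral_all.
  - by move=> x _; exact: emaximal_ge0.
  - move=> x _; rewrite adde_ge0 ?lee_fin ?(ltW t_gt0)//; exact: nneseries_ge0.
  - by apply: aeW => x _; exact: emaximal_le_layers.
rewrite ge0_integralD//; first last.
- apply: (@ge0_emeasurable_sum _ _ _ Q (fun k x => (t * 2 ^+ k)%:E * (\1_(lev k) x)%:E)
    xpredT) => [k x _ _|k _]; [exact: term0|exact: mind].
- by move=> x _; exact: nneseries_ge0.
- by move=> x _; rewrite lee_fin ltW.
have -> : \int[mu]_(x in Q) t%:E = (2^-1)%:E * weight_of w Q.
  transitivity (t%:E * mu Q); first exact: (integral_cst mu mQ t%:E).
  rewrite lebesgue_box_set; last exact: ltW.
  by rewrite -WK -!EFinM; congr EFin; rewrite /t; field; rewrite gt_eqF.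
rewrite integral_nneseries//.
rewrite -WK EFinD -!EFinM mulrDl EFinD; apply: leeD2l.
apply: (@le_trans _ _ (\sum_(k <oo) (3 ^+ n)%:E * \int[mu]_(x in lev k) h x)).
  apply: lee_nneseries => [k _ _|k _]; first exact: integral_ge0.
  have t2 : (0 <= t * 2 ^+ k)%R by rewrite mulr_ge0 ?exprn_ge0// ltW.
  apply: le_trans (weak_type_superlevel mh h0 t2).
  rewrite ge0_integralZl//; first last.
  - by apply/measurable_EFinP; apply: measurable_indic; exact: measurable_level.
  apply: lee_wpmul2l => //.
  rewrite integral_indic//; last exact: measurable_level.
  apply: le_measure; rewrite ?inE.
  - by apply: measurableI => //; exact: measurable_level.
  - exact: measurable_level.
  - exact: subIsetl.
rewrite nneseriesZl//; last by move=> k _; exact: integral_ge0.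
rewrite -mulrA EFinM; apply: lee_wpmul2l; first by rewrite lee_fin exprn_ge0.
apply: lime_le; first by apply: is_cvg_nneseries => k _ _; exact: integral_ge0.
by apply: nearW => N; rewrite EFinM WK; exact: sum_integral_level.
Qed.

End local_weight.

Lemma fujii_wilson_le : fujii_wilson w <= (2^-1 + 3 ^+ n * (A + B * C))%:E.
Proof.
apply: ge_ereal_sup => _ [_ [a [r [r0 ->]]] <-].
have Wfin := weight_of_fin_num mw w_gt0 lw (p := (a, r)) r0.
have W0 := weight_of_gt0 mw w_gt0 (p := (a, r)) r0.
have W00 : (0 < fine (weight_of w (box_set (a, r))))%R by rewrite fine_gt0// W0 ltey_eq Wfin.
have := @integral_maximal_weight (a, r) r0.
rewrite /box_set /= in Wfin W00 *.
rewrite -(fineK Wfin) inver gt_eqF// => H.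
by rewrite lee_pdivrMr.
Qed.

(** The test function is built on the indicator of a cell P of level d of the unit
    cube q carrying at least 2^-(n d) / 2 of the weight of q.  Its maximal function
    is 1 on P and t is 2^-(n d) / 2, so all the d = A + 1 levels contain P, and the
    staircase exceeds A by 1 there. *)
Lemma constant_ge : (2^-1 * 2^-1 ^+ (n * (8 * 9 ^ n).+1) / B <= C)%R.
Proof.
pose d := (8 * 9 ^ n).+1.
pose q : box := (nseq_tuple n (0%R : measurableTypeR R), 1%R).
have q0 : (0 < q.2)%R by exact: ltr01.
have mww := measurable_weight mw.
have w0 x : 0 <= (w x)%:E by rewrite lee_fin ltW.
have Wfin := weight_of_fin_num mw w_gt0 lw q0.
have W0 := weight_of_gt0 mw w_gt0 q0.
have WE := weight_of_half_open_box mw w_gt0 q0.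
have W00 : (0 < fine (weight_of w (box_set q)))%R by rewrite fine_gt0// W0 ltey_eq Wfin.
have [|x Tx heavy] := heavy_cell (a := q.1) (r := q.2) q0 n_gt0 d mww w0.
  by rewrite -/(weight_of w _) -[half_open_cube _ _]/(half_open_box q) -WE W0 ltey_eq Wfin.
pose P := cell q.1 q.2 d x.
have mP : measurable P by exact: measurable_cell.
have PQ : P `<=` box_set q by move=> y /(cell_sub q0 Tx) /half_open_cube_sub.
pose h : vec R n -> \bar R := fun y => (\1_P y)%:E.
have mh : measurable_fun setT h by apply/measurable_EFinP; exact: measurable_indic.
have h0 y : 0 <= h y by rewrite lee_fin.
pose t : R := (2^-1 * 2^-1 ^+ (n * d))%R.
have t0 : (0 < t)%R by rewrite mulr_gt0 ?exprn_gt0// invr_gt0.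
have muP : mu P = (2 * t)%:E.
  rewrite /P lebesgue_cell// /cell_side /t; congr EFin.
  by rewrite mulrA divff// !mul1r -exprVn -exprM mulnC.
have IE D : measurable D -> \int[mu]_(y in D) h y = mu (P `&` D).
  by move=> mD; exact: integral_indic.
have h_mass : \int[mu]_y h y <= (2 * t * q.2 ^+ n)%:E.
  by rewrite IE// setIT muP /= expr1n mulr1.
have h_large y : box_set q y -> t%:E < emaximal h y.
  move=> qy; apply/emaximal_gtP; exists q => //.
  rewrite IE; last exact: measurable_box_set.
  rewrite setIidl// muP lte_fin /= expr1n mulr1; lra.
have := staircase_excess mh h0 q0 t0 h_mass h_large (N := d) isT.
rewrite -(fineK Wfin) => excess.
have big y : P y -> (1 <= Num.max (staircase h t d y - A) 0)%R.
  move=> Py; rewrite le_max; apply/orP; left.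
  have : (d%:R <= staircase h t d y)%R.
    apply: staircase_ge => // k kd; rewrite /level /=; apply/emaximal_gtP.
    exists (cell_box q.1 q.2 d (cell_index q.1 q.2 d x)).
      by split; [exact: cell_side_gt0|exact: half_open_cube_sub Py].
    rewrite IE; last exact: measurable_box_set.
    rewrite setIidl; last by move=> z; exact: half_open_cube_sub.
    rewrite lebesgue_cell// lte_fin gtr_pMl ?exprn_gt0 ?cell_side_gt0//.
    have k2 : (2 ^+ k <= 2 ^+ (n * d) :> R)%R.
      by rewrite ler_eXn2l ?ltr1n// (leq_trans (ltnW kd))// leq_pmull.
    have : (2^-1 ^+ (n * d) * 2 ^+ k <= 1 :> R)%R.
      by rewrite exprVn mulrC ler_pdivrMr ?exprn_gt0// mul1r.
    rewrite /t; lra.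
  rewrite /d -natr1 natrM natrX /A; lra.
have mww' : measurable_fun P (fun y => (w y)%:E).
  exact: (@measurable_funS _ _ _ _ setT).
have lower : (B^-1)%:E * \int[mu]_(y in P) (w y)%:E <=
    C%:E * (fine (weight_of w (box_set q)))%:E.
  apply: le_trans excess; rewrite -ge0_integralZl//; last by rewrite lee_fin invr_ge0 ltW.
  have exc0 y : (0 <= Num.max (staircase h t d y - A) 0 / B * w y)%R.
    by rewrite mulr_ge0 ?(ltW (w_gt0 _))// divr_ge0 ?(ltW B_gt0)// le_max lexx orbT.
  apply: (@le_trans _ _ (\int[mu]_(y in P)
      (Num.max (staircase h t d y - A) 0 / B * w y)%:E)).
    apply: ae_ge0_le_integral_all.
    - by move=> y _; rewrite -EFinM lee_fin mulr_ge0 ?invr_ge0 ?(ltW B_gt0)// ltW.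
    - by move=> y _; rewrite lee_fin.
    - apply: aeW => y Py; rewrite -EFinM lee_fin ler_wpM2r ?(ltW (w_gt0 _))//.
      by rewrite ler_peMl ?invr_ge0 ?(ltW B_gt0)//; exact: big.
  apply: ge0_subset_integral => //; first exact: measurable_box_set.
    exact: (measurable_funS _ _ (measurable_excess mh h0 t d)).
  by move=> y _; rewrite lee_fin.
have Bi : 0 <= (B^-1)%:E by rewrite lee_fin invr_ge0 ltW.
have := le_trans (lee_wpmul2l Bi heavy) lower.
rewrite -/(weight_of w _) -[half_open_cube _ _]/(half_open_box q) -WE -(fineK Wfin).
rewrite -!EFinM lee_fin mulrA ler_pM2r// => /(le_trans _); apply.
by rewrite mulrC.
Qed.


End necessity.

(** * Borel representatives and the conclusion *)
Section almost_everywhere_equal.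
Context {R : realType} {n : nat}.
Local Notation mu := (lebesgue_vec R n).
Implicit Types (f g w : vec R n -> R) (x : vec R n).

Lemma mean_ae f g Q : {ae mu, forall x, f x = g x} -> mean f Q = mean g Q.
Proof.
move=> fg; congr (_ / _)%R; congr fine; apply: ae_eq_integral_all.
by apply: filterS fg => x /= ->.
Qed.

Lemma maximal_ae f g : {ae mu, forall x, f x = g x} -> maximal f = maximal g.
Proof.
move=> fg; apply/funext => x; congr ereal_sup; apply: eq_imagel => Q _; congr (_ / _).
by apply: ae_eq_integral_all; apply: filterS fg => y /= ->.
Qed.

Lemma sharp_maximal_ae f g : {ae mu, forall x, f x = g x} ->
  sharp_maximal f = sharp_maximal g.
Proof.
move=> fg; apply/funext => x.
pose F (u : vec R n -> R) Q := (\int[mu]_(y in Q) `|u y - mean u Q|%:E) / mu Q.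
have FE : F f = F g.
  apply/funext => Q; rewrite /F (mean_ae Q fg); apply: (congr1 (fun I => I / mu Q)).
  by apply: ae_eq_integral_all; apply: filterS fg => y /= ->.
exact: (congr1 (fun G => ereal_sup (G @` [set Q | is_cube Q /\ Q x])) FE).
Qed.

Lemma weight_of_ae w g Q : {ae mu, forall x, w x = g x} ->
  weight_of w Q = weight_of g Q.
Proof.
by move=> wg; apply: ae_eq_integral_all; apply: filterS wg => x /= ->.
Qed.

Lemma fujii_wilson_ae w g : {ae mu, forall x, w x = g x} ->
  fujii_wilson w = fujii_wilson g.
Proof.
move=> wg; congr ereal_sup; apply: eq_imagel => Q _.
rewrite (weight_of_ae Q wg) (@maximal_ae _ (g \_ Q))//.
by apply: filterS wg => x; rewrite !patchE => ->.
Qed.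

Lemma ratio_norm_ae w v f g Q p : {ae mu, forall x, w x = v x} ->
  {ae mu, forall x, f x = g x} -> ratio_norm w f Q p = ratio_norm v g Q p.
Proof.
move=> wv fg; rewrite /ratio_norm (weight_of_ae Q wv) (maximal_ae fg) (sharp_maximal_ae fg).
apply: (congr1 (fun I => (I / weight_of v Q) `^ p^-1)); apply: ae_eq_integral_all.
by apply: filterS wv => x /= ->.
Qed.

Lemma borel_representative f : locally_integrable_vec f ->
  exists g, [/\ measurable_fun setT g, {ae mu, forall x, f x = g x} &
    forall p : vec R n * R, (0 < p.2)%R -> \int[mu]_(x in box_set p) `|g x|%:E < +oo].
Proof.
move=> [[g mg fg] lf]; exists g; split=> // p p0.
rewrite (_ : \int[mu]_(x in box_set p) `|g x|%:E = \int[mu]_(x in box_set p) `|f x|%:E).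
  by apply: lf; exists p.1, p.2.
by apply: ae_eq_integral_all; apply: filterS fg => x /= ->.
Qed.

(** On the null set where the Borel representative fails to be positive it is
    replaced by 1, so that the weight is positive everywhere. *)
Lemma borel_weight w : weight w ->
  exists g, [/\ measurable_fun setT g, {ae mu, forall x, w x = g x},
    forall x, (0 < g x)%R &
    forall p : vec R n * R, (0 < p.2)%R -> \int[mu]_(x in box_set p) (g x)%:E < +oo].
Proof.
move=> [/borel_representative[g [mg wg lg]] w0].
pose v x := if (0 < g x)%R then g x else 1%R.
have gv : {ae mu, forall x, g x = v x}.
  by apply: filterS2 wg w0 => x wgx; rewrite wgx /v => ->.
have v0 x : (0 < v x)%R by rewrite /v; case: ifPn.
exists v; split => //.
- apply: measurable_fun_ifT => //.
  by apply: measurable_fun_ltr => //; exact: measurable_cst.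
- by apply: filterS2 wg gv => x ->.
- move=> p p0; rewrite (_ : \int[mu]_(x in box_set p) (v x)%:E =
      \int[mu]_(x in box_set p) `|g x|%:E); first exact: lg.
  apply: ae_eq_integral_all; apply: filterS gv => x /= gvx _.
  by rewrite gvx gtr0_norm.
Qed.

End almost_everywhere_equal.

Theorem corollary1p6 (R : realType) (n : nat) (hn : (0 < n)%N) :
  exists c c' : R, [/\ (0 < c)%R, (0 < c')%R &
    forall w : vec R n -> R, weight w ->
      (forall f : vec R n -> R,
         locally_integrable_vec f -> nonconstant f ->
         ~ (forall x, maximal f x = +oo) ->
         A_infty w ->
         forall (Q : set (vec R n)) (p : R), is_cube Q -> (1 <= p)%R ->
           ratio_norm w f Q p <= c%:E * fujii_wilson w * p%:E)
      /\
      (forall C : R,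
         (forall f : vec R n -> R,
            locally_integrable_vec f -> nonconstant f ->
            ~ (forall x, maximal f x = +oo) ->
            forall (Q : set (vec R n)) (p : R), is_cube Q -> (1 <= p)%R ->
              ratio_norm w f Q p <= (C * p)%:E) ->
         A_infty w /\ fujii_wilson w <= (c' * C)%:E)].
Proof.
pose A : R := (8 * 9 ^+ n)%R; pose B : R := (4 * 9 ^+ n)%R.
pose c0 : R := (2^-1 * 2^-1 ^+ (n * (8 * 9 ^ n).+1) / B)%R.
have A0 : (0 < A)%R by rewrite mulr_gt0// exprn_gt0.
have B0 : (0 < B)%R by rewrite mulr_gt0// exprn_gt0.
have c00 : (0 < c0)%R by rewrite divr_gt0// mulr_gt0 ?exprn_gt0// invr_gt0.
have D0 : (0 < 2^-1 + 3 ^+ n * A)%R.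
  by rewrite addr_gt0 ?invr_gt0// mulr_gt0// exprn_gt0.
exists (12 * @step_constant R n)%R, (3 ^+ n * B + (2^-1 + 3 ^+ n * A) / c0)%R; split.
- by rewrite mulr_gt0// step_constant_gt0.
- by rewrite addr_gt0 ?mulr_gt0 ?exprn_gt0// invr_gt0.
move=> w /borel_weight[v [mv wv v0 lv]]; split.
- move=> f /borel_representative[g [mg fg lg]] _ Mf Aw _ p [a [r [r0 ->]]] p1.
  have Av : A_infty v by rewrite /A_infty -(fujii_wilson_ae wv).
  have Mg : exists x, maximal g x < +oo.
    apply: contrapT => Mg; apply: Mf => x; rewrite (maximal_ae fg).
    by apply: contrapT => gx; apply: Mg; exists x; rewrite ltey; exact/eqP.
  rewrite (ratio_norm_ae _ _ wv fg) (fujii_wilson_ae wv).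
  exact: (sufficiency_borel hn mv v0 lv Av mg lg Mg (q := (a, r))).
- move=> C HC.
  have HCv f (lf : locally_integrable_vec f) (nf : nonconstant f)
      (Mf : ~ (forall x, maximal f x = +oo)) Q p (cQ : is_cube Q) (p1 : (1 <= p)%R) :
      ratio_norm v f Q p <= (C * p)%:E.
    by rewrite -(ratio_norm_ae _ _ wv (aeW _ (fun=> erefl _))); exact: HC.
  have FW : fujii_wilson w <= (2^-1 + 3 ^+ n * (A + B * C))%:E.
    by rewrite (fujii_wilson_ae wv); exact: (fujii_wilson_le hn mv v0 lv HCv).
  have Cge : (c0 <= C)%R by exact: (constant_ge hn mv v0 lv HCv).
  split; first exact: le_lt_trans FW (ltry _).
  apply: (le_trans FW); rewrite lee_fin mulrDl.
  have : (2^-1 + 3 ^+ n * A <= (2^-1 + 3 ^+ n * A) / c0 * C)%R.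
    by rewrite -mulrA ler_peMr ?(ltW D0)// mulrC ler_pdivlMr// mul1r.
  rewrite [(3 ^+ n * (A + B * C))%R]mulrDr [(3 ^+ n * (B * C))%R]mulrA.
  lra.
Qed.
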